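(* Let $d\geq 1$ be an integer. For any positive integers $n$, $s$ there exists a finite set of primes $P(n,s)$ such that $\mu_s(\mathbb{Q}_p(t_1,\dots,t_n))\leq d^{n+2}$ for all primes $p\notin P(n,s)$.
   Context: A form of degree $d$ over a field $F$ is a homogeneous polynomial of degree $d$ over $F$; its dimension is the number of variables; it is anisotropic if it has no nontrivial zero over $F$. Two forms are isometric if one is obtained from the other by an invertible linear change of variables over $F$. For a field $k$ and $K=k(t_1,\dots,t_n)$, and an integer $s$, let $M_s(K)$ be the set of all (not necessarily nondegenerate) forms $\varphi$ of degree $d$ over $K$ which are isometric to a form of degree $d$ whose coefficients are polynomials in $k[t_1,\dots,t_n]$ of total degree at most $s$. Define $\mu_s(K)=\sup\{\dim\varphi \mid \varphi\in M_s(K) \text{ and } \varphi \text{ is anisotropic over } K\}$. *)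

(* Defs.v *)
(* mpoly must be imported before constructive_ereal and ereal: in the opposite
   order their notations clash. *)
From HB Require Import structures.
From mathcomp Require Import all_boot all_order all_algebra.
From mathcomp Require Import mpoly.
From mathcomp Require Import boolp classical_sets.
From mathcomp Require Import constructive_ereal reals ereal.

Set Implicit Arguments.
Unset Strict Implicit.
Unset Printing Implicit Defensive.

Import GRing.Theory.
Local Open Scope ring_scope.

(* The ring Z_p is the inverse limit of the rings Z/p^(n+1), n : nat, realized
   as a subring of their product. The exponents start at 1 because 'Z_1 is not
   the zero ring. *)

Definition padic_seq (p : nat) := forall n : nat, 'Z_(p ^ n.+1).

HB.instance Definition _ p := Choice.copy (padic_seq p)
  (forall n : nat, 'Z_(p ^ n.+1)).

Section PadicSeqRing.
Variable p : nat.
Implicit Types x y z : padic_seq p.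

Definition padic_seq0 : padic_seq p := fun=> 0.
Definition padic_seq1 : padic_seq p := fun=> 1.
Definition padic_seq_opp x : padic_seq p := fun n => - x n.
Definition padic_seq_add x y : padic_seq p := fun n => x n + y n.
Definition padic_seq_mul x y : padic_seq p := fun n => x n * y n.

Lemma padic_seqP x y : (forall n, x n = y n) -> x = y.
Proof. exact: functional_extensionality_dep. Qed.

Fact padic_seq_addA : associative padic_seq_add.
Proof. by move=> x y z; apply: padic_seqP => n; apply: addrA. Qed.
Fact padic_seq_addC : commutative padic_seq_add.
Proof. by move=> x y; apply: padic_seqP => n; apply: addrC. Qed.
Fact padic_seq_add0 : left_id padic_seq0 padic_seq_add.
Proof. by move=> x; apply: padic_seqP => n; apply: add0r. Qed.
Fact padic_seq_addN : left_inverse padic_seq0 padic_seq_opp padic_seq_add.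
Proof. by move=> x; apply: padic_seqP => n; apply: addNr. Qed.

HB.instance Definition _ := GRing.isZmodule.Build (padic_seq p)
  padic_seq_addA padic_seq_addC padic_seq_add0 padic_seq_addN.

Fact padic_seq_mulA : associative padic_seq_mul.
Proof. by move=> x y z; apply: padic_seqP => n; apply: mulrA. Qed.
Fact padic_seq_mulC : commutative padic_seq_mul.
Proof. by move=> x y; apply: padic_seqP => n; apply: mulrC. Qed.
Fact padic_seq_mul1 : left_id padic_seq1 padic_seq_mul.
Proof. by move=> x; apply: padic_seqP => n; apply: mul1r. Qed.
Fact padic_seq_mulD : left_distributive padic_seq_mul padic_seq_add.
Proof. by move=> x y z; apply: padic_seqP => n; apply: mulrDl. Qed.
Fact padic_seq_oner_neq0 : padic_seq1 != 0.
Proof.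
by apply/eqP => /(congr1 (fun x : padic_seq p => x 0%N)) /eqP;
   rewrite oner_eq0.
Qed.

HB.instance Definition _ := GRing.Zmodule_isComNzRing.Build (padic_seq p)
  padic_seq_mulA padic_seq_mulC padic_seq_mul1 padic_seq_mulD
  padic_seq_oner_neq0.

End PadicSeqRing.

Definition padic_compat (p : nat) (p_pr : prime p) : {pred padic_seq p} :=
  fun x => `[< forall n, x n.+1 = x n %[mod p ^ n.+1] >].

Section PadicInt.
Variables (p : nat) (p_pr : prime p).

Fact padic_modulus n : (Zp_trunc (p ^ n.+1)).+2 = (p ^ n.+1)%N.
Proof. by apply: Zp_cast; rewrite -{1}(exp1n n.+1) ltn_exp2r // prime_gt1. Qed.

Fact padic_seq_addE (x y : padic_seq p) n :
  ((x + y)%R n : nat) = ((x n + y n) %% p ^ n.+1)%N.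
Proof. by congr (_ %% _)%N; apply: padic_modulus. Qed.

Fact padic_seq_mulE (x y : padic_seq p) n :
  ((x * y)%R n : nat) = ((x n * y n) %% p ^ n.+1)%N.
Proof. by congr (_ %% _)%N; apply: padic_modulus. Qed.

Fact padic_seq_lt (x : padic_seq p) n : (x n < p ^ n.+1)%N.
Proof. by move: (ltn_ord (x n)); rewrite [X in (_ < X)%N]padic_modulus. Qed.

Fact padic_compatP (x : padic_seq p) :
  reflect (forall n, x n.+1 = x n %[mod p ^ n.+1])
          (x \in padic_compat p_pr).
Proof. exact: asboolP. Qed.

Let modX n (a : nat) : (a %% p ^ n.+2 = a %[mod p ^ n.+1])%N.
Proof. by rewrite modn_dvdm // dvdn_exp2l. Qed.

Fact padic_compat_subring : subring_closed (padic_compat p_pr).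
Proof.
have oppE (x : padic_seq p) n : ((- x)%R n + x n = 0 %[mod p ^ n.+1])%N.
  by rewrite mod0n -padic_seq_addE addNr.
split.
- apply/padic_compatP => n.
  suff E m : ((1%R : padic_seq p) m : nat) = (1 %% p ^ m.+1)%N.
    by rewrite !E modX modn_mod.
  by rewrite -[in RHS](padic_modulus m).
- move=> x y /padic_compatP cx /padic_compatP cy; apply/padic_compatP => n.
  have cN : (- y)%R n.+1 = (- y)%R n %[mod p ^ n.+1].
    apply/eqP; rewrite -(eqn_modDr (y n)) oppE -modnDmr -cy modnDmr.
    by rewrite -modX oppE mod0n.
  rewrite !padic_seq_addE modX modn_mod -modnDml cx modnDml.
  by rewrite -modnDmr cN modnDmr.
- move=> x y /padic_compatP cx /padic_compatP cy; apply/padic_compatP => n.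
  rewrite !padic_seq_mulE modX modn_mod -modnMml cx modnMml.
  by rewrite -modnMmr cy modnMmr.
Qed.

HB.instance Definition _ := GRing.isSubringClosed.Build (padic_seq p)
  (padic_compat p_pr) padic_compat_subring.

Record padic_int := PadicInt {
  padic_val : padic_seq p;
  _ : padic_val \in padic_compat p_pr }.

HB.instance Definition _ := [isSub for padic_val].
HB.instance Definition _ := [Choice of padic_int by <:].
HB.instance Definition _ := [SubChoice_isSubComNzRing of padic_int by <:].

Definition padic_unit : {pred padic_int} :=
  fun x => `[< exists y : padic_int, y * x = 1 >].

Definition padic_inv (x : padic_int) : padic_int :=
  if pselect (exists y : padic_int, y * x = 1) is left ex_y then xchoose
    (let: ex_intro y yx1 := ex_y in ex_intro (fun y => y * x == 1) y
                                      (introT eqP yx1)) else x.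

Fact padic_mulVx : {in padic_unit, left_inverse 1 padic_inv *%R}.
Proof.
move=> x /asboolP ux; rewrite /padic_inv; case: pselect => // ex_y.
by apply/eqP; apply: (xchooseP (P := fun y => y * x == 1)).
Qed.

Fact padic_unitP (x y : padic_int) : y * x = 1 -> padic_unit x.
Proof. by move=> yx1; apply/asboolP; exists y. Qed.

Fact padic_inv_out : {in [predC padic_unit], padic_inv =1 id}.
Proof.
move=> x /negP ux; rewrite /padic_inv; case: pselect => // ex_y.
by case: ux; apply/asboolP.
Qed.

HB.instance Definition _ := GRing.ComNzRing_hasMulInverse.Build padic_int
  padic_mulVx padic_unitP padic_inv_out.

Fact padic_compat_le (x : padic_int) m n :
  (m <= n)%N -> padic_val x n = padic_val x m %[mod p ^ m.+1].
Proof.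
move=> /subnK <-; elim: (n - m)%N => // k IHk; rewrite addSn -IHk.
have /padic_compatP/(_ (k + m)%N) := valP x.
move/(congr1 (modn^~ (p ^ m.+1)%N)).
by rewrite !modn_dvdm // dvdn_exp2l // ltnS leq_addl.
Qed.

Fact padic_int_neq0 (x : padic_int) :
  x != 0 -> exists n, ~~ (p ^ n.+1 %| padic_val x n)%N.
Proof.
move=> x_neq0; apply: contrapT => x_dvd; case/eqP: x_neq0.
apply/val_inj/padic_seqP => n; apply/val_inj; rewrite /=.
have [|ndvd] := boolP (p ^ n.+1 %| padic_val x n)%N; last first.
  by case: x_dvd; exists n.
by rewrite /dvdn modn_small ?padic_seq_lt // => /eqP.
Qed.

Fact padic_int_integral (x y : padic_int) :
  x * y = 0 -> (x == 0) || (y == 0).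
Proof.
move=> xy0; apply/norP => -[/padic_int_neq0[a xa] /padic_int_neq0[b yb]].
pose n := (a + b).+1.
have nx : ~~ (p ^ a.+1 %| padic_val x n)%N.
  by rewrite /dvdn (@padic_compat_le x a n) // /n -addnS leq_addr.
have ny : ~~ (p ^ b.+1 %| padic_val y n)%N.
  by rewrite /dvdn (@padic_compat_le y b n) // /n -addSn leq_addl.
have x_gt0 : (0 < padic_val x n)%N by rewrite lt0n; apply: contraNneq nx => ->.
have y_gt0 : (0 < padic_val y n)%N by rewrite lt0n; apply: contraNneq ny => ->.
have : (p ^ n.+1 %| padic_val x n * padic_val y n)%N.
  by rewrite /dvdn -padic_seq_mulE -[_ * _]/(val (x * y)) xy0.
rewrite !pfactor_dvdn ?muln_gt0 ?x_gt0 // lognM //.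
move: nx ny; rewrite !pfactor_dvdn // -!ltnNge !ltnS => lx ly.
by apply/negP; rewrite -ltnNge ltnS; apply/leqW/leq_add.
Qed.

HB.instance Definition _ := GRing.ComUnitRing_isIntegral.Build padic_int
  padic_int_integral.

Definition padic_field : fieldType := {fraction padic_int}.

End PadicInt.

Definition anisotropic (F : fieldType) (m : nat) (phi : {mpoly F[m]}) : Prop :=
  forall v : 'I_m -> F, phi.@[v] = 0 -> forall i, v i = 0.

Definition isometric (F : fieldType) (m : nat)
    (phi psi : {mpoly F[m]}) : Prop :=
  exists2 A : 'M[F]_m, A \in unitmx &
    psi = phi \mPo [tuple \sum_(j < m) A i j *: 'X_j | i < m].

Definition ratfun (k : fieldType) (n : nat) : fieldType :=
  {fraction {mpoly k[n]}}.

(* msize q is one more than the total degree of q if q is nonzero, and msize 0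
   is 0. *)
Definition coeffs_le (k : fieldType) (n s m : nat)
    (psi : {mpoly (ratfun k n)[m]}) : Prop :=
  forall a : 'X_{1..m},
    exists2 q : {mpoly k[n]}, (msize q <= s.+1)%N & psi@_a = tofrac q.

(* The forms of dimension m that belong to M_s(k(t_1, ..., t_n)). *)
Definition M_ (d s : nat) (k : fieldType) (n m : nat) :
    set {mpoly (ratfun k n)[m]} :=
  [set phi | phi \is d.-homog /\
     exists psi : {mpoly (ratfun k n)[m]},
       [/\ psi \is d.-homog, coeffs_le s psi & isometric phi psi]].

(* The supremum is taken in the extended reals, so that it may be +oo; R is any
   model of the real numbers. *)
Definition mu (R : realType) (d s : nat) (k : fieldType) (n : nat) : \bar R :=
  ereal_sup [set (m%:R)%:E | m in
    [set m : nat | exists2 phi, M_ d s phi & @anisotropic (ratfun k n) m phi]].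

(* Main.v *)
(* For m > d^(n+2), write the unknown vector as polynomials in t_1, ..., t_n of
   degree at most D in each variable: a form of dimension m whose coefficients
   have degree at most s becomes a system of about (d D)^n forms of degree d in
   m D^n unknowns over Q_p, and m D^n > d^2 (d D)^n. So it is enough to solve
   systems of r forms of degree d in N > d^2 r unknowns over Z_p, for p large
   with respect to d, r and N. Over F_p[[t]] this holds for all p: by the
   argument of Lang and Chevalley's theorem there are primitive solutions
   modulo every power of t, and a solution by compactness.
   The transfer to Z_p follows Ax, Kochen and Cohen. The leading term of a
   nonzero element is its valuation together with the residue of its unit part,
   and leading terms over Z_p and F_p[[t]] live in the same set. Given finitely
   many polynomials over Z, if two tuples over the two rings give the same
   leading term to each polynomial of a suitable finite list, then every
   extension of one tuple by an element can be imitated in the other ring,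
   provided that p is large. Indeed one can move the center c of the Taylor
   expansions of the polynomials towards the new element x, using roots given by
   Hensel's lemma, until no term of these expansions cancels at x. *)
Require Import Defs.
From mathcomp Require Import ring zify.
From HB Require Import structures.
From mathcomp Require Import all_boot all_order all_algebra.
From mathcomp Require Import finfield.
From mathcomp Require Import mpoly.
From mathcomp Require Import boolp classical_sets filter.
From mathcomp Require Import constructive_ereal reals ereal.

Set Implicit Arguments.
Unset Strict Implicit.
Unset Printing Implicit Defensive.

Import GRing.Theory.
Local Open Scope ring_scope.

(* A complete discrete valuation ring with residue field F. Integrality follows
   from the other axioms. *)
Record cdvr (F : fieldType) := Cdvr {
  cdvr_sort :> comNzRingType;
  unif : cdvr_sort;
  res : {rmorphism cdvr_sort -> F};
  res_eq0 : forall x, res x = 0 <-> exists y, x = unif * y;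
  res_surj : forall c, exists x, res x = c;
  unif_reg : forall x, unif * x = 0 -> x = 0;
  unif_sep : forall x, (forall n, exists y, x = unif ^+ n * y) -> x = 0;
  unif_complete : forall s : nat -> cdvr_sort,
    (forall n, exists y, s n.+1 - s n = unif ^+ n * y) ->
    exists l, forall n, exists y, l - s n = unif ^+ n * y }.
Arguments unif {F V} : rename.
Arguments res {F V} : rename.

(** * Leading terms in a complete discrete valuation ring *)

Section LeadingTerm.
Variables (F : fieldType) (V : cdvr F).
Implicit Types (x y u : V) (n : nat).

Lemma res_unif : res (unif : V) = 0.
Proof. by apply/res_eq0; exists 1; rewrite mulr1. Qed.

Lemma res1 : res (1 : V) = 1.
Proof. exact: rmorph1. Qed.

Lemma res_horner (p : {poly V}) x y : res x = res y -> res p.[x] = res p.[y].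
Proof. by move=> xy; rewrite -!horner_map xy. Qed.

Lemma unifX_reg n x : unif ^+ n * x = 0 -> x = 0.
Proof.
elim: n => [|n IHn]; first by rewrite mul1r.
by rewrite exprS -mulrA => /unif_reg.
Qed.

Lemma unifX_inj n : injective ( *%R (unif ^+ n : V)).
Proof.
move=> x y /eqP; rewrite -subr_eq0 -mulrBr => /eqP /unifX_reg /eqP.
by rewrite subr_eq0 => /eqP.
Qed.

Lemma unif_decomp x : x <> 0 -> exists n u, x = unif ^+ n * u /\ res u != 0.
Proof.
move=> x0; apply: contrapT => nex; apply: x0; apply: unif_sep => n.
elim: n => [|n [y xE]]; first by exists x; rewrite mul1r.
have [y0|ny0] := eqVneq (res y) 0; last by case: nex; exists n, y.
by have /res_eq0[z yE] := y0; exists z; rewrite exprSr -mulrA -yE.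
Qed.

Lemma expr_neq0 x k : x <> 0 -> x ^+ k <> 0.
Proof.
move=> /unif_decomp[n [u [-> u0]]].
rewrite exprMn -exprM => /unifX_reg /(congr1 res) /eqP.
by rewrite rmorphXn rmorph0 expf_eq0 (negPf u0) andbF.
Qed.

Lemma unif_decomp_le m n x y : unif ^+ m * x = unif ^+ n * y ->
  res x != 0 -> (n <= m)%N.
Proof.
move=> E x0; rewrite leqNgt; apply/negP => lt_mn; move: E.
rewrite -(subnKC lt_mn) exprD exprSr -!mulrA => /unifX_inj xE.
by move: x0; rewrite xE rmorphM res_unif mul0r eqxx.
Qed.

Lemma unif_decomp_uniq m n x y : unif ^+ m * x = unif ^+ n * y ->
  res x != 0 -> res y != 0 -> m = n /\ x = y.
Proof.
move=> E x0 y0; have mn : m = n.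
  by apply/eqP; rewrite eqn_leq (unif_decomp_le E x0) (unif_decomp_le (esym E) y0).
by split=> //; move: E; rewrite mn => /unifX_inj.
Qed.

Lemma unifX_mul m n x y :
  unif ^+ m * x * (unif ^+ n * y) = unif ^+ (m + n) * (x * y).
Proof. by rewrite mulrACA exprD. Qed.

Definition is_lead x (r : nat * F) :=
  exists u, [/\ x = unif ^+ r.1 * u, res u = r.2 & r.2 != 0].

(* The leading term of x, an element of the set RV = V/(1 + unif V) seen as
   (nat * F) + {0}. *)
Definition rv x : option (nat * F) :=
  if pselect (exists r, is_lead x r) is left h then Some (projT1 (cid h))
  else None.

Lemma rvE n u : res u != 0 -> rv (unif ^+ n * u) = Some (n, res u).
Proof.
move=> u0; rewrite /rv; case: pselect => [h|[]]; last first.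
  by exists (n, res u), u.
case: (cid h) => -[m c] /= [w /= [E wc c0]]; rewrite -wc in c0 *.
by have [-> ->] := unif_decomp_uniq E u0 c0.
Qed.

Lemma rv1 : rv 1 = Some (0%N, 1).
Proof. by rewrite -[1](mulr1 1) -{1}(expr0 unif) rvE rmorph1 ?oner_neq0. Qed.

Lemma rv0 : rv 0 = None.
Proof.
rewrite /rv; case: pselect => // -[[n c] [u /= [E uc c0]]].
by case/eqP: (c0); rewrite -uc (unifX_reg (esym E)) rmorph0.
Qed.

Variant rv_spec x : option (nat * F) -> Type :=
  | RvZero : x = 0 -> rv_spec x None
  | RvLead n u : x = unif ^+ n * u -> res u != 0 -> rv_spec x (Some (n, res u)).

Lemma rvP x : rv_spec x (rv x).
Proof.
have [->|/eqP/unif_decomp/cid[n /cid[u [-> u0]]]] := eqVneq x 0.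
  by rewrite rv0; left.
by rewrite rvE //; right.
Qed.

Lemma rv_eq0 x : rv x = None -> x = 0.
Proof. by case: rvP. Qed.

End LeadingTerm.

Section SameLeadingTerm.
Variables (F : fieldType) (V V' : cdvr F).

(** The power [unif ^+ n] need not be the exact one dividing [x]: if it is smaller, both residues
    are 0. This covers a power of [unif] common to all coefficients of a polynomial. *)
Lemma rv_decomp (x : V) (x' : V') n u : rv x = rv x' -> x = unif ^+ n * u ->
  exists2 u', x' = unif ^+ n * u' & res u' = res u.
Proof.
case: (rvP x) => [->|m w xE w0] + E.
  move/esym/rv_eq0 ->; exists 0; first by rewrite mulr0.
  by rewrite (unifX_reg (esym E)) !rmorph0.
case: (rvP x') => // m' w' -> w'0 [<- rw].
have le_nm : (n <= m)%N by apply: (unif_decomp_le (y := u) _ w0); rewrite -xE E.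
exists (unif ^+ (m - n) * w'); first by rewrite mulrA -exprD subnKC.
move: E; rewrite xE -{1}(subnKC le_nm) exprD -mulrA => /unifX_inj <-.
by rewrite !rmorphM !rmorphXn !res_unif /= rw.
Qed.

Lemma rvM (x y : V) (x' y' : V') :
  rv x = rv x' -> rv y = rv y' -> rv (x * y) = rv (x' * y').
Proof.
case: (rvP x) => [->|m u -> u0]; case: (rvP x') => //.
  by move=> ->; rewrite !mul0r !rv0.
move=> m' u' -> u0' [-> uu]; case: (rvP y) => [->|n w -> w0]; case: (rvP y') => //.
  by move=> ->; rewrite !mulr0 !rv0.
move=> n' w' -> w0' [-> ww].
by rewrite !unifX_mul !rvE ?rmorphM ?mulf_neq0 // uu ww.
Qed.

Lemma rvX (x : V) (x' : V') n : rv x = rv x' -> rv (x ^+ n) = rv (x' ^+ n).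
Proof.
move=> E; elim: n => [|n IHn]; first by rewrite !rv1.
by rewrite !exprS; apply: rvM.
Qed.

Lemma rv_mulI (x y : V) (x' y' : V') :
  rv x = rv x' -> x <> 0 -> rv (x * y) = rv (x' * y') ->
  rv y = rv y'.
Proof.
case: (rvP x) => // m u -> u0; case: (rvP x') => // m' u' -> u0' [-> uu] _.
case: (rvP y) => [->|n w -> w0]; case: (rvP y') => //.
- by move=> n w -> w0; rewrite mulr0 unifX_mul rv0 rvE // rmorphM mulf_neq0.
- by move=> ->; rewrite mulr0 unifX_mul rv0 rvE // rmorphM mulf_neq0.
move=> n' w' -> w0'; rewrite !unifX_mul !rvE ?rmorphM ?mulf_neq0 // uu.
by case=> /eqP; rewrite eqn_add2l => /eqP -> /(mulfI u0') ->.
Qed.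

Lemma rv_surj (x : V) : exists x' : V', rv x = rv x'.
Proof.
case: (rvP x) => [_|n u _ u0]; first by exists 0; rewrite rv0.
have [u' uu] := res_surj V' (res u).
by exists (unif ^+ n * u'); rewrite rvE uu.
Qed.

End SameLeadingTerm.

(** * Hensel's lemma and noncancellation *)

Section Hensel.
Variables (F : fieldType) (V : cdvr F).
Implicit Types (p H : {poly V}).

Lemma horner_taylor2 (R : comNzRingType) (p : {poly R}) (y h : R) :
  exists k, p.[y + h] = p.[y] + p^`().[y] * h + h ^+ 2 * k.
Proof.
elim/poly_ind: p => [|p c [k IHp]].
  by exists 0; rewrite deriv0 !horner0 mul0r mulr0 !addr0.
exists (p^`().[y] + k * (y + h)); rewrite !derivE !hornerE IHp; ring.
Qed.

Lemma hensel p z : res p.[z] = 0 -> res p^`().[z] != 0 ->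
  exists2 b, p.[b] = 0 & res b = res z.
Proof.
move=> pz0 dpz; have [g gE] := res_surj V (res p^`().[z])^-1.
pose s n := iter n (fun y => y - g * p.[y]) z.
have sS n : s n.+1 = s n - g * p.[s n] by [].
have sP n : res (s n) = res z /\ exists w, p.[s n] = unif ^+ n.+1 * w.
  elim: n => [|n [rs [w pw]]].
    by split=> //; have /res_eq0[w ->] := pz0; exists w; rewrite expr1.
  split; first by rewrite sS pw rmorphB !rmorphM rmorphXn res_unif
    exprS !mul0r mulr0 subr0.
  have [k] := horner_taylor2 p (s n) (- (g * p.[s n])).
  have /res_eq0[v vE] : res (1 - g * p^`().[s n]) = 0.
    rewrite rmorphB rmorphM rmorph1 (res_horner _ rs) gE.
    by rewrite mulVf ?subrr.
  rewrite sS pw => ->; exists (w * v + unif ^+ n * (g * w) ^+ 2 * k).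
  have -> : unif ^+ n.+1 * w + p^`().[s n] * - (g * (unif ^+ n.+1 * w)) =
    unif ^+ n.+1 * w * (1 - g * p^`().[s n]) by ring.
  by rewrite vE !exprS; ring.
have [n|l lP] := @unif_complete F V s.
  have [_ [w pw]] := sP n; exists (- (g * unif * w)).
  by rewrite sS pw exprS; ring.
exists l; last first.
  have [y /eqP] := lP 1%N; rewrite subr_eq => /eqP ->.
  by rewrite rmorphD rmorphM rmorphXn res_unif expr1 mul0r add0r (sP 1%N).1.
apply: unif_sep => n; have [y yE] := lP n; have [_ [w pw]] := sP n.
have [k] := horner_taylor2 p (s n) (l - s n); rewrite subrKC => ->.
rewrite pw yE; exists (unif * w + p^`().[s n] * y + unif ^+ n * y ^+ 2 * k).
by rewrite exprS; ring.
Qed.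

Lemma unifX_scale_inj n : injective ( *:%R (unif ^+ n : V) : {poly V} -> {poly V}).
Proof.
move=> p q /polyP pq; apply/polyP => i; move: (pq i).
by rewrite !coefZ => /unifX_inj.
Qed.

Lemma poly_unif H : map_poly res H = 0 -> exists K, H = unif *: K.
Proof.
move=> /polyP H0; have /choice[k kP] i : exists y, H`_i = unif * y.
  by apply/res_eq0; rewrite -coef_map H0 coef0.
exists (\poly_(i < size H) k i); apply/polyP => i; rewrite coefZ coef_poly.
by case: ltnP => [_|lei]; [apply: kP|rewrite nth_default ?mulr0].
Qed.

Lemma poly_unif_decomp p : p <> 0 ->
  exists n H, p = unif ^+ n *: H /\ map_poly res H <> 0.
Proof.
move=> p0; apply: contrapT => nex; apply: p0; apply/polyP => i; rewrite coef0.
suff h n : exists H, p = unif ^+ n *: H.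
  by apply: unif_sep => n; have [H ->] := h n; exists H`_i; rewrite coefZ.
elim: n => [|n [H pE]]; first by exists p; rewrite scale1r.
have [H0|nH0] := pselect (map_poly res H = 0); last by case: nex; exists n, H.
by have [K HE] := poly_unif H0; exists K; rewrite exprSr -scalerA -HE.
Qed.

End Hensel.

(** * Taylor expansions around a center *)

Section Recenter.
Variable R : comNzRingType.
Implicit Types (p : {poly R}) (c y z : R).

(** For [y = x - c], the coefficients are the terms of the Taylor expansion of [p] at [c] for the
    increment [y], and the value at 1 is [p.[x]]. *)
Definition recenter p c y := p \Po (y *: 'X + c%:P).

Lemma horner_recenter p c y z : (recenter p c y).[z] = p.[c + y * z].
Proof. by rewrite horner_comp !hornerE addrC. Qed.

Lemma deriv_recenter p c y : (recenter p c y)^`() = y *: recenter p^`() c y.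
Proof.
by rewrite deriv_comp !derivE addr0 -mul_polyC mulr1 mulrC mul_polyC.
Qed.

Lemma recenter_recenter p c y z w :
  recenter (recenter p c y) z w = recenter p (c + y * z) (y * w).
Proof.
rewrite /recenter -comp_polyA; congr (_ \Po _).
rewrite comp_polyD comp_polyZ comp_polyX comp_polyC scalerDr scalerA -addrA.
by rewrite -!mul_polyC -!polyCM -polyCD [_ + c]addrC.
Qed.

Lemma coef_recenter p c y j : (recenter p c y)`_j = p^`N(j).[c] * y ^+ j.
Proof.
rewrite /recenter /comp_poly addrC.
rewrite (@nderiv_taylor_wide _ (maxn (size p) j.+1)); last 2 first.
- exact: mulrC.
- by rewrite (leq_trans (size_poly _ _)) // leq_maxl.
rewrite coef_sum (bigD1 (Ordinal (leq_maxr (size p) j.+1))) //= big1.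
  rewrite addr0 nderivn_map horner_map /= exprZn -scalerAr coefZ coefCM coefXn.
  by rewrite eqxx mulr1 mulrC.
move=> i ij; rewrite nderivn_map horner_map /= exprZn -scalerAr coefZ coefCM coefXn.
have [jE|_] := eqVneq j i; last by rewrite !mulr0.
by case/eqP: ij; apply/val_inj.
Qed.

End Recenter.

Section NonCancellation.
Variables (F : fieldType) (V : cdvr F).
Implicit Types (P Q H : {poly V}).

(* Equivalently, the valuation of P.[1] is the minimum of those of the
   coefficients of P. *)
Definition noncancel P :=
  P = 0 \/ exists m H, P = unif ^+ m *: H /\ res H.[1] != 0.

(** The point 1 in the new coordinate is [z + w] in the old one. Its residue is still 1, so [H]
    remains a unit there. *)
Lemma noncancel_recenter P z w : res (z + w) = 1 -> noncancel P ->
  noncancel (recenter P z w).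
Proof.
move=> zw [->|[m [H [-> H1]]]]; first by left; rewrite /recenter comp_poly0.
right; exists m, (recenter H z w); split; first exact: comp_polyZ.
by rewrite horner_recenter mulr1 (res_horner H (y := 1)) ?res1.
Qed.

(** Write [H = K * ('X - z)]. Recentering at [z] turns the linear factor into [w *: 'X], and [K] is
    a unit near the simple root [z]. *)
Lemma noncancel_root H m z w : H.[z] = 0 -> res z = 1 -> res w = 0 ->
  res H^`().[z] != 0 -> noncancel (unif ^+ m *: recenter H z w).
Proof.
move=> /eqP/factor_theorem[K HE] z1 w0 dH.
have Kz : res K.[z] != 0.
  by move: dH; rewrite HE derivM !derivE !hornerE subrr mulr0 add0r.
have Kzw : res K.[z + w] != 0.
  by rewrite (res_horner K (y := z)) // rmorphD w0 addr0.
have -> : recenter H z w = w *: ('X * recenter K z w).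
  rewrite HE /recenter comp_polyM comp_polyB comp_polyX comp_polyC addrK.
  by rewrite -scalerAr mulrC.
have [->|/eqP/unif_decomp[n [u [wE u0]]]] := eqVneq w 0.
  by left; rewrite scale0r scaler0.
right; exists (m + n)%N, (u *: ('X * recenter K z w)); split.
  by rewrite {1}wE !scalerA exprD mulrA.
by rewrite hornerZ hornerM hornerX mul1r horner_recenter mulr1 rmorphM mulf_neq0.
Qed.

(** Divide [P] by the largest power of [unif]. The quotient [H] is nonzero modulo [unif] and
    vanishes at 1 there, so it is not constant, and its derivative is nonzero modulo [unif] by the
    hypothesis on the characteristic. As [Q] does not cancel, neither does that derivative, whose
    value at 1 is then a unit. *)
Lemma cancel_deriv P Q y : P^`() = y *: Q -> noncancel Q -> ~ noncancel P ->
  (forall i, (0 < i < size P)%N -> i%:R != 0 :> F) ->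
  exists m H, [/\ P = unif ^+ m *: H, res H.[1] = 0 & res H^`().[1] != 0].
Proof.
move=> PQ ncQ cP iF.
have [|m [H [PE H0]]] := @poly_unif_decomp _ _ P; first by move=> P0; apply: cP; left.
have H1 : res H.[1] = 0.
  by have [//|H1] := eqVneq (res H.[1]) 0; case: cP; right; exists m, H.
exists m, H; split=> //.
have [j dH] : exists j, res H^`()`_j != 0.
  apply: contrapT => nex; apply: H0.
  suff Hc : map_poly res H = ((map_poly res H)`_0)%:P.
    by move: H1; rewrite -horner_map Hc !hornerE => ->.
  apply/polyP => -[|i]; rewrite coefC //= coef_map /=.
  have [lt_i|le_i] := ltnP i.+1 (size P); last first.
    have : unif ^+ m * H`_i.+1 = 0 by rewrite -coefZ -PE nth_default.
    by move/unifX_reg ->; rewrite rmorph0.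
  have [//|Hi] := eqVneq (res H`_i.+1) 0; case: nex; exists i.
  by rewrite coef_deriv rmorphMn -mulr_natr mulf_neq0 // iF.
have HJ : unif ^+ m *: H^`() = y *: Q by rewrite -derivZ -PE.
have nyQ : y *: Q <> 0.
  move=> yQ0; case/eqP: dH; suff -> : H^`() = 0 by rewrite coef0 rmorph0.
  by apply: (@unifX_scale_inj _ _ m); rewrite HJ yQ0 scaler0.
case: ncQ => [Q0|[n [J [QE J1]]]]; first by case: nyQ; rewrite Q0 scaler0.
have [|k [u [yE u0]]] := @unif_decomp _ _ y.
  by move=> y0; apply: nyQ; rewrite y0 scale0r.
have {}HJ : unif ^+ m *: H^`() = unif ^+ (k + n) *: (u *: J).
  by rewrite HJ QE yE !scalerA exprD mulrAC.
have uJ1 : res (u *: J).[1] != 0 by rewrite hornerZ rmorphM mulf_neq0.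
have le1 : (k + n <= m)%N.
  by apply: unif_decomp_le dH; rewrite -coefZ HJ coefZ.
have le2 : (m <= k + n)%N.
  by apply: unif_decomp_le uJ1; rewrite -hornerZ -HJ hornerZ.
have mE : m = (k + n)%N by apply/eqP; rewrite eqn_leq le1 le2.
by move: HJ; rewrite -mE => /unifX_scale_inj ->.
Qed.

End NonCancellation.

(** * Polynomials whose coefficients have matching leading terms *)

Section MatchPoly.
Variables (F : fieldType) (V V' : cdvr F) (P : {poly V}) (P' : {poly V'}).
Hypothesis PP' : forall j, rv P`_j = rv P'`_j.

Lemma match_poly0 : P = 0 -> P' = 0.
Proof.
move=> P0; apply/polyP => j; move: (PP' j).
by rewrite P0 !coef0 rv0 => /esym/rv_eq0.
Qed.

Lemma match_poly_decomp m (H : {poly V}) : P = unif ^+ m *: H ->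
  exists2 H', P' = unif ^+ m *: H' & map_poly res H' = map_poly res H.
Proof.
move=> PE; have /choice[h hP] j : exists u', P'`_j = unif ^+ m * u' /\ res u' = res H`_j.
  have [|u' ? ?] := @rv_decomp _ _ _ P`_j P'`_j m H`_j (PP' j); last by exists u'.
  by rewrite PE coefZ.
exists (\poly_(j < maxn (size P') (size H)) h j); apply/polyP => j.
  rewrite coefZ coef_poly; case: ltnP => [_|]; first by case: (hP j).
  by rewrite geq_max mulr0 => /andP[lej _]; rewrite nth_default.
rewrite !coef_map coef_poly; case: ltnP => [_|]; first by case: (hP j).
by rewrite geq_max => /andP[_ lej]; rewrite (nth_default _ lej) [LHS]rmorph0 [RHS]rmorph0.
Qed.

(** Without cancellation the leading term of the value is given by the common power of [unif] and by
    the reduction of [H] at 1, which is the same over both rings. *)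
Lemma match_noncancel z z' : res z = 1 -> res z' = 1 -> noncancel P ->
  rv P.[z] = rv P'.[z'].
Proof.
move=> z1 z1' [P0|[m [H [PE H1]]]].
  by rewrite (match_poly0 P0) P0 !horner0 !rv0.
have [H' P'E HH] := match_poly_decomp PE.
have Hz : res H.[z] != 0 by rewrite (res_horner H (y := 1)) // z1 res1.
have HE : res H'.[z'] = res H.[z] by rewrite -!horner_map HH z1 z1'.
by rewrite P'E PE !hornerZ !rvE ?HE.
Qed.

End MatchPoly.

(** * Transfer between two rings with the same residue field *)

Section Centers.
Variable A : comNzRingType.
Implicit Types (g h : {poly A}) (G L M : seq {poly A}).

Definition rv_match (F : fieldType) (V V' : cdvr F) (B : Type)
  (f : B -> V) (f' : B -> V') b := rv (f b) = rv (f' b).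

(** The characteristic is 0 or greater than [e]. *)
Definition big_char (F : fieldType) (e : nat) :=
  forall i, (0 < i <= e)%N -> i%:R != 0 :> F.

(* The center c is close enough to x for the Taylor expansions at c to give
   the leading terms at x of the polynomials of L. The companion c' plays the
   same role in V', and G is an arbitrary list since c may later have to be
   replaced with a root of a polynomial of higher degree. *)
Definition centered L := forall G, exists (G0 : seq A) e,
  forall (F : fieldType) (V V' : cdvr F), big_char F e ->
  forall (f : {rmorphism A -> V}) (f' : {rmorphism A -> V'}),
  {in G0, forall a, rv_match f f' a} ->
  forall x, exists c c',
    {in G, forall g, rv_match (horner_eval c \o map_poly f)
                       (horner_eval c' \o map_poly f') g} /\
    {in L, forall h, noncancel (recenter (map_poly f h) c (x - c))}.

Lemma centered_sub L L' : {subset L' <= L} -> centered L -> centered L'.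
Proof.
move=> sL cL G; have [G0 [e H]] := cL G; exists G0, e => F V V' Fe f f' ff x.
have [c [c' [mG ncL]]] := H F V V' Fe f f' ff x.
by exists c, c'; split=> // h /sL; apply: ncL.
Qed.

Definition nderivs (h : {poly A}) := [seq h^`N(j) | j <- iota 0 (size h)].

Lemma match_recenter (F : fieldType) (V V' : cdvr F)
    (f : {rmorphism A -> V}) (f' : {rmorphism A -> V'}) (h : {poly A}) c c' y y' :
  {in nderivs h, forall g, rv_match (horner_eval c \o map_poly f)
                       (horner_eval c' \o map_poly f') g} ->
  rv y = rv y' -> forall j,
  rv (recenter (map_poly f h) c y)`_j = rv (recenter (map_poly f' h) c' y')`_j.
Proof.
move=> mh yy j; rewrite !coef_recenter !nderivn_map.
have [ltj|lej] := ltnP j (size h); last first.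
  by rewrite !nderivn_poly0 // !rmorph0 !horner0 !mul0r !rv0.
by apply: rvM (rvX j yy); apply: mh; apply/mapP; exists j; rewrite ?mem_iota.
Qed.

Lemma size_recenter (R : comNzRingType) (p : {poly R}) c y :
  (size (recenter p c y) <= size p)%N.
Proof.
apply/leq_sizeP => j lej.
by rewrite coef_recenter nderivn_poly0 // horner0 mul0r.
Qed.

(* If g cancels at x with respect to c but its derivative does not, Hensel's
   lemma yields a root b of g that is closer to x, which becomes the new center.
   The value at b of a polynomial h of arbitrary degree is, up to a power of the
   leading coefficient of g, that of its pseudo-remainder by g, whose degree is
   smaller than that of g and which does not cancel at x. *)
Lemma centered_cons D g L : size g = D.+1 ->
  (forall M, all (fun h => size h <= D)%N M -> centered (L ++ M)) ->
  forall M, all (fun h => size h <= D)%N M -> centered (g :: L ++ M).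
Proof.
move=> gD cL M MD G.
(* The list [M] is enlarged by polynomials of degree less than that of [g]: the derivative, for
   [cancel_deriv]; [g1], which replaces [g] if its leading coefficient maps to 0; and the
   remainders, which give the values at the new center. *)
pose g1 := g - lead_coef g *: 'X^D.
pose M1 := g^`() :: g1 :: [seq Pdiv.Ring.rmodp h g | h <- G] ++ M.
have g_neq0 : g != 0 by rewrite -size_poly_gt0 gD.
have M1D : all (fun h => size h <= D)%N M1.
  rewrite /= all_cat MD andbT -ltnS -gD lt_size_deriv //=; apply/andP; split.
    apply/leq_sizeP => j; rewrite /g1 coefB coefZ coefXn leq_eqVlt.
    case/predU1P => [<-|ltDj]; first by rewrite eqxx mulr1 lead_coefE gD subrr.
    by rewrite nth_default ?gD // gtn_eqF // mulr0 subrr.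
  by rewrite all_map; apply/allP => h _ /=; rewrite -ltnS -gD Pdiv.Ring.ltn_rmodpN0.
have [G0 [e H]] := cL M1 M1D (G ++ flatten [seq nderivs h | h <- g :: M1]).
(* The leading coefficient must match since its powers are cancelled at the end; the bound [size g]
   on the characteristic is for [cancel_deriv]. *)
exists (lead_coef g :: G0), (maxn e (size g)) => F V V' Fe f f' ff x.
have [|i|c [c' [mG ncL]]] := H F V V' _ f f' _ x.
- by move=> i /andP[i0 ie]; apply: Fe; rewrite i0 leq_max ie.
- by move=> iG0; apply: ff; rewrite inE iG0 orbT.
have mG' h : h \in g :: M1 -> {in nderivs h, forall k,
    rv_match (horner_eval c \o map_poly f) (horner_eval c' \o map_poly f') k}.
  move=> hM k kh; apply: mG; rewrite mem_cat; apply/orP; right.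
  by apply/flattenP; exists (nderivs h) => //; apply/map_f.
have mgl : rv (f (lead_coef g)) = rv (f' (lead_coef g)).
  by apply: ff; rewrite inE eqxx.
have keep_center : noncancel (recenter (map_poly f g) c (x - c)) ->
  exists c c', {in G, forall g, rv_match (horner_eval c \o map_poly f)
                       (horner_eval c' \o map_poly f') g} /\
    {in g :: L ++ M, forall h, noncancel (recenter (map_poly f h) c (x - c))}.
  move=> ncg; exists c, c'; split=> [h hG|h]; first by apply: mG; rewrite mem_cat hG.
  rewrite inE => /predU1P[-> //|]; rewrite mem_cat => hLM; apply: ncL.
  by rewrite mem_cat !inE mem_cat; case/orP: hLM => ->; rewrite ?orbT.
have [ncg|ncg] := pselect (noncancel (recenter (map_poly f g) c (x - c))).
  exact: keep_center.
have [lg0|lg0] := pselect (f (lead_coef g) = 0).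
  apply: keep_center; have -> : map_poly f g = map_poly f g1.
    by rewrite rmorphB /= map_polyZ lg0 scale0r subr0.
  by apply: ncL; rewrite mem_cat !inE eqxx !orbT.
have ncM1 h : h \in M1 -> noncancel (recenter (map_poly f h) c (x - c)).
  by move=> hM1; apply: ncL; rewrite mem_cat hM1 orbT.
pose y := x - c; have [y' yy] := rv_surj V' y.
have mP h (hM : h \in g :: M1) := match_recenter (mG' h hM) yy.
have [||m [K [PE K1 dK]]] := cancel_deriv (deriv_recenter _ _ _) _ ncg.
- by rewrite deriv_map; apply: ncM1; rewrite inE eqxx.
- move=> i /andP[i0 lti]; apply: Fe; rewrite i0 leq_max; apply/orP; right.
  apply: leq_trans (ltnW lti) _; apply: leq_trans (size_recenter _ _ _) _.
  exact: size_poly.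
have [K' PE' KK] := match_poly_decomp (mP g (mem_head _ _)) PE.
have [z Kz z1] := hensel K1 dK.
(* [K'] has the same reduction as [K], hence also a simple root at 1 modulo [unif]. *)
have [||z' Kz' z1'] := @hensel _ V' K' 1.
- by rewrite -horner_map KK res1 -K1 -horner_map res1.
- by move: dK; rewrite -!horner_map -!deriv_map KK !res1.
have gb : (map_poly f g).[c + y * z] = 0.
  by rewrite -horner_recenter PE hornerZ Kz mulr0.
have gb' : (map_poly f' g).[c' + y' * z'] = 0.
  by rewrite -horner_recenter PE' hornerZ Kz' mulr0.
exists (c + y * z), (c' + y' * z'); split.
  move=> h hG; rewrite /rv_match /= /horner_eval.
  have hM1 : Pdiv.Ring.rmodp h g \in M1.
    by rewrite !inE mem_cat (map_f (fun k => Pdiv.Ring.rmodp k g) hG) !orbT.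
  have := match_noncancel (mP _ (mem_behead (s := g :: M1) hM1)) _ _ (ncM1 _ hM1).
  move/(_ z z'); rewrite z1 z1' !res1 !horner_recenter => /(_ erefl erefl).
  have hE (W : cdvr F) (k : {rmorphism A -> W}) b : (map_poly k g).[b] = 0 ->
    (map_poly k (Pdiv.Ring.rmodp h g)).[b] =
    k (lead_coef g) ^+ Pdiv.Ring.rscalp h g * (map_poly k h).[b].
    move=> gb0; have := Pdiv.ComRing.rdivp_eq g h.
    move/(congr1 (fun p => (map_poly k p).[b])).
    rewrite map_polyZ rmorphD rmorphM /= !hornerE gb0 mulr0 add0r rmorphXn => <-.
    by [].
  rewrite !hE //; apply: rv_mulI; first exact: rvX.
  exact: expr_neq0.
(* The increment from the new center is [y * (1 - z)], where [1 - z] has residue 0. *)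
have xb : x - (c + y * z) = y * (1 - z) by rewrite /y; ring.
have z1z : res (z + (1 - z)) = 1 by rewrite subrKC res1.
move=> h; rewrite xb -recenter_recenter inE => /predU1P[->|hLM].
  rewrite PE /recenter comp_polyZ; apply: noncancel_root => //.
  - by rewrite z1 res1.
  - by rewrite rmorphB z1 subrr.
  - by rewrite (res_horner _ (y := 1)) // z1 res1.
apply: noncancel_recenter z1z _; apply: ncL; move: hLM.
by rewrite !mem_cat !inE mem_cat; case/orP => ->; rewrite ?orbT.
Qed.

(** Induction on the degree bound, and then on the number of polynomials of maximal degree. The list
    [M] of polynomials of smaller degree is kept arbitrary because [centered_cons] enlarges it. *)
Lemma centered_bounded D L : all (fun h => size h <= D)%N L -> centered L.
Proof.
elim: D L => [|D IHD] L LD.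
  (* Here [L] contains only the zero polynomial, so the center 0 works in both rings as soon as the
     constant terms match. *)
  move=> G; exists [seq g.[0] | g <- G], 0%N => F V V' _ f f' ff x.
  exists 0, 0; split=> [g gG|h hL].
    by rewrite /rv_match /= /horner_eval -!(rmorph0 f) -!(rmorph0 f') !horner_map;
       apply/ff/map_f.
  move/allP/(_ _ hL): LD; rewrite leqn0 size_poly_eq0 => /eqP ->.
  by left; rewrite rmorph0 /recenter comp_poly0.
suff h L1 : all (fun h => size h <= D.+1)%N L1 ->
    forall M, all (fun h => size h <= D)%N M -> centered (L1 ++ M).
  by have := h L LD [::] isT; rewrite cats0.
elim: L1 => [_ M /IHD //|g L1 IHL /= /andP[gD L1D] M MD].
have [gE|gE] := eqVneq (size g) D.+1; first exact: centered_cons gE (IHL L1D) M MD.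
have gMD : all (fun h => size h <= D)%N (g :: M).
  by rewrite /= MD andbT -ltnS ltn_neqAle gE gD.
apply: centered_sub (IHL L1D _ gMD) => k.
by rewrite !(inE, mem_cat) orbCA.
Qed.

(** Take centers [c], [c'] for [G] and put [x' = c' + y'], where [y'] has the leading term of
    [x - c]. The Taylor terms then match, and they do not cancel. *)
Lemma rv_match_extend G : exists (G0 : seq A) e,
  forall (F : fieldType) (V V' : cdvr F), big_char F e ->
  forall (f : {rmorphism A -> V}) (f' : {rmorphism A -> V'}),
  {in G0, forall a, rv_match f f' a} ->
  forall x, exists x', {in G, forall g,
    rv_match (horner_eval x \o map_poly f) (horner_eval x' \o map_poly f') g}.
Proof.
have [|G0 [e H]] := @centered_bounded (\max_(g <- G) size g) G _ (flatten (map nderivs G)).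
  by apply/allP => g gG; rewrite (big_rem g) //= leq_maxl.
exists G0, e => F V V' Fe f f' ff x.
have [c [c' [mG ncG]]] := H F V V' Fe f f' ff x.
have [y' yy] := rv_surj V' (x - c); exists (c' + y') => g gG.
have mg : {in nderivs g, forall k,
    rv_match (horner_eval c \o map_poly f) (horner_eval c' \o map_poly f') k}.
  by move=> k kg; apply: mG; apply/flattenP; exists (nderivs g) => //; apply: map_f.
have := match_noncancel (match_recenter mg yy) (res1 _) (res1 _) (ncG g gG).
by rewrite !horner_recenter !mulr1 subrKC.
Qed.

End Centers.

(** * Transfer for integer polynomials in several variables *)

Section IteratedPolynomials.

(** The ring of integer polynomials in [k] variables, built one variable at a time so that
    [rv_match_extend] applies with [A := ipoly k]. *)
Fixpoint ipoly k : comNzRingType :=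
  if k is k'.+1 then {poly ipoly k'} else int.

Fixpoint ivar k (i : nat) : ipoly k :=
  if k is k'.+1 return ipoly k
  then if i == k' then 'X else (ivar k' i)%:P else 0.

Fixpoint ieval (R : comNzRingType) (a : nat -> R) k : {rmorphism ipoly k -> R} :=
  if k is k'.+1 return {rmorphism ipoly k -> R}
  then horner_eval (a k') \o map_poly (ieval a k') else intmul 1.

Lemma ieval_ivar (R : comNzRingType) (a : nat -> R) k i :
  (i < k)%N -> ieval a k (ivar k i) = a i.
Proof.
elim: k => // k IHk; rewrite ltnS leq_eqVlt /=; case: eqVneq => [->|_ /= ik].
  by rewrite map_polyX /horner_eval hornerX.
by rewrite map_polyC /horner_eval hornerC; apply: IHk.
Qed.

Lemma ieval_eq (R : comNzRingType) (a b : nat -> R) k :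
  (forall i, (i < k)%N -> a i = b i) -> ieval a k =1 ieval b k.
Proof.
elim: k => // k IHk ab p /=; rewrite /horner_eval ab //.
congr _.[_]; apply: eq_map_poly; apply: IHk => i /ltnW; exact: ab.
Qed.

Lemma rv_match_extend_iter k m (G : seq (ipoly (m + k))) :
  exists (G0 : seq (ipoly k)) e,
  forall (F : fieldType) (V V' : cdvr F), big_char F e ->
  forall (a : nat -> V) (a' : nat -> V'),
  {in G0, forall g, rv_match (ieval a k) (ieval a' k) g} ->
  forall b, (forall i, (i < k)%N -> b i = a i) ->
  exists2 b', (forall i, (i < k)%N -> b' i = a' i) &
    {in G, forall g, rv_match (ieval b (m + k)) (ieval b' (m + k)) g}.
Proof.
elim: m G => [|m IHm] G.
  exists G, 0%N => F V V' _ a a' aa b ba; exists a' => // g gG.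
  by rewrite /rv_match (ieval_eq ba); apply: aa.
have [G1 [e1 H1]] := rv_match_extend (G : seq {poly ipoly (m + k)}).
have [G0 [e0 H0]] := IHm G1.
exists G0, (maxn e0 e1) => F V V' Fe a a' aa b ba.
have [||b' ba' bb'] := H0 F V V' _ a a' _ b ba => //.
  by move=> i /andP[i0 ie]; apply: Fe; rewrite i0 leq_max ie.
have [||x' xx'] := H1 F V V' _ (ieval b (m + k)) (ieval b' (m + k)) _ (b (m + k)%N) => //.
  by move=> i /andP[i0 ie]; apply: Fe; rewrite i0 leq_max ie orbT.
pose c' i := if i == (m + k)%N then x' else b' i.
have cb' i : (i < m + k)%N -> c' i = b' i by rewrite /c' => /ltn_eqF ->.
exists c' => [i ik|g gG]; first by rewrite cb' ?ba' // ltn_addl.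
have c'E : c' (m + k)%N = x' by rewrite /c' eqxx.
rewrite /rv_match /= c'E /horner_eval.
by rewrite (eq_map_poly (ieval_eq cb')); apply: xx'.
Qed.

(** A nonzero integer of absolute value at most [e] is nonzero in [F], so in both rings it has
    valuation 0 and the same residue. *)
Lemma rv_match_int (G : seq int) : exists e,
  forall (F : fieldType) (V V' : cdvr F), big_char F e ->
  {in G, forall z, rv_match (intmul (1 : V)) (intmul (1 : V')) z}.
Proof.
exists (\max_(z <- G) `|z|%N) => F V V' Fe z zG.
have [->|z0] := eqVneq z 0; first by rewrite /rv_match !mulr0z !rv0.
have resz (W : cdvr F) : res (z%:~R : W) = z%:~R by rewrite rmorph_int.
have rz : z%:~R != 0 :> F.
  have : (`|z|%N%:R : F) != 0.
    by apply: Fe; rewrite absz_gt0 z0 (big_rem z) //= leq_maxl.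
  by case: z {zG z0 resz} => n //=; rewrite NegzE mulrNz oppr_eq0.
by rewrite /rv_match -[_ z]mul1r -[in RHS](mul1r (_ z)) -!(expr0 unif) !rvE ?resz.
Qed.

(** Back and forth: the parameters [a] are imitated in [V'], and then the unknowns chosen in [V']
    are imitated in [V]. The lists are found in the reverse order, from [G] down to a list of
    integers. *)
Lemma rv_transfer n N (G : seq (ipoly (N + n))) : exists e,
  forall (F : fieldType) (V V' : cdvr F), big_char F e ->
  forall a : nat -> V, exists a' : nat -> V', forall b' : nat -> V',
  (forall i, (i < n)%N -> b' i = a' i) ->
  exists2 b : nat -> V, (forall i, (i < n)%N -> b i = a i) &
    {in G, forall g, rv_match (ieval b (N + n)) (ieval b' (N + n)) g}.
Proof.
have [G1 [e1 H1]] := rv_match_extend_iter G.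
have := @rv_match_extend_iter 0 n; rewrite addn0 => /(_ G1)[G2 [e2 H2]].
have [e3 H3] := rv_match_int G2.
exists (maxn e1 (maxn e2 e3)) => F V V' Fe a.
have [|||a' _ aa'] := H2 F V V' _ a (fun=> 0) _ a => //.
- by move=> i /andP[i0 ie]; apply: Fe; rewrite i0 !leq_max ie orbT.
- by apply: H3 => i /andP[i0 ie]; apply: Fe; rewrite i0 !leq_max ie !orbT.
exists a' => b' ba'; have [||b ba bb'] := H1 F V' V _ a' a _ b' ba'.
- by move=> i /andP[i0 ie]; apply: Fe; rewrite i0 !leq_max ie.
- by move=> g gG; apply/esym/aa'.
by exists b => // g gG; apply/esym/bb'.
Qed.

End IteratedPolynomials.

(** * Systems of forms over power series *)

Section Forms.

(* Any d-form can be written with a coefficient for each noncommutative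
   monomial, i.e. as a not necessarily symmetric tensor. *)
Definition form (R : comNzRingType) (I : finType) d
  (b : {ffun 'I_d -> I} -> R) (x : I -> R) : R := \sum_W b W * \prod_k x (W k).

Definition solvable (R : comNzRingType) d (I J : finType) :=
  forall b : J -> {ffun 'I_d -> I} -> R,
  exists2 x : I -> R, (exists i, x i != 0) & forall j, form (b j) x = 0.

(** Only 0 has leading term [None]. Matching the forms transfers their vanishing, and matching the
    unknowns transfers nontriviality. *)
Lemma solvable_transfer d (I J : finType) : exists e,
  forall (F : fieldType) (V V' : cdvr F), big_char F e ->
  solvable V' d I J -> solvable V d I J.
Proof.
(* The variables below [n] stand for the coefficients of the forms, the next [N] ones for the
   unknowns. *)
pose M := (J * {ffun 'I_d -> I})%type; pose n := #|{: M}|; pose N := #|I|.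
pose cvar (jW : M) := ivar (N + n) (enum_rank jW).
pose xvar (i : I) := ivar (N + n) (n + enum_rank i).
pose eqn j := \sum_W cvar (j, W) * \prod_k xvar (W k).
have [e H] := @rv_transfer n N ([seq eqn j | j <- enum J] ++ [seq xvar i | i <- enum I]).
exists e => F V V' Fe solV' b.
pose a i := nth 0 [seq b jW.1 jW.2 | jW <- enum {: M}] i.
have [a' aP] := H F V V' Fe a.
have [x' [i0 xi0] xj] := solV' (fun j W => a' (enum_rank ((j, W) : M))).
pose b' i := if (i < n)%N then a' i else nth 0 [seq x' i | i <- enum I] (i - n).
have ltM (t : M) : (enum_rank t < n)%N by exact: ltn_ord.
have ltI (i : I) : (enum_rank i < N)%N by exact: ltn_ord.
have b'c (jW : M) : b' (enum_rank jW : nat) = a' (enum_rank jW : nat).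
  by rewrite /b' (ltM jW).
have b'x i : b' (n + enum_rank i)%N = x' i.
  rewrite /b' ltnNge leq_addr /= addKn (nth_map i) -?cardE //.
  by rewrite nth_enum_rank.
have [c cP matched] := aP b' (fun i lt => ifT _ _ lt).
pose x (i : I) := c (n + enum_rank i)%N.
have evalE (R : comNzRingType) (u : nat -> R) j : ieval u (N + n) (eqn j) =
    \sum_(W : {ffun 'I_d -> I}) u (enum_rank ((j, W) : M)) * \prod_k u (n + enum_rank (W k))%N.
  rewrite rmorph_sum; apply: eq_bigr => W _; rewrite rmorphM rmorph_prod /=.
  rewrite ieval_ivar ?ltn_addl //; congr (_ * _); apply: eq_bigr => k _.
  by rewrite ieval_ivar // addnC ltn_add2r.
exists x => [|j].
  exists i0; apply: contra_neq xi0 => xi0; apply: (@rv_eq0 _ V').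
  have lt0 : (n + enum_rank i0 < N + n)%N by rewrite addnC ltn_add2r.
  have /matched : xvar i0 \in [seq eqn j | j <- enum J] ++ [seq xvar i | i <- enum I].
    by rewrite mem_cat map_f ?orbT ?mem_enum.
  by rewrite /rv_match !ieval_ivar // b'x => <-; rewrite -/(x i0) xi0 rv0.
have /matched : eqn j \in [seq eqn j | j <- enum J] ++ [seq xvar i | i <- enum I].
  by rewrite mem_cat map_f ?mem_enum.
rewrite /rv_match !evalE (eq_bigr (fun W => b j W * \prod_k x (W k))) => [E|W _].
  apply: (@rv_eq0 _ V); rewrite /form E.
  transitivity (rv (form (fun W => a' (enum_rank ((j, W) : M))) x')); last by rewrite xj rv0.
  congr rv; apply: eq_bigr => W _; rewrite b'c; congr (_ * _).
  by apply: eq_bigr => k _; rewrite b'x.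
rewrite cP // /a (nth_map (j, W)) -?cardE ?(ltM (j, W)) //.
by rewrite nth_enum_rank.
Qed.

End Forms.

(** * Chevalley's theorem over a finite field *)

Lemma prod_count_mem (R : comNzRingType) (I : finType) (x : I -> R) (s : seq I) :
  \prod_(i <- s) x i = \prod_i x i ^+ count_mem i s.
Proof.
elim: s => [|j s IHs]; first by rewrite big_nil big1.
rewrite big_cons IHs /=; under [RHS]eq_bigr do rewrite exprD.
rewrite big_split /=; congr (_ * _).
by rewrite (bigD1 j) //= eqxx big1 ?mulr1 // => i; rewrite eq_sym => /negPf ->.
Qed.

Lemma sum_count_mem (I : finType) (s : seq I) : size s = (\sum_i count_mem i s)%N.
Proof.
elim: s => [|j s IHs] /=; first by rewrite big1.
rewrite big_split /= -IHs (bigD1 j) //= eqxx big1 // => i.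
by rewrite eq_sym => /negPf ->.
Qed.

Section Chevalley.
Variable F : finFieldType.

(** If [c = 0], the translation by 1 shows that the cardinal of [F] vanishes in [F]. Otherwise some
    nonzero [g] has [g ^+ c != 1], as there are at most [c] roots of unity of order dividing [c],
    and the substitution of [g * a] for [a] multiplies the sum by [g ^+ c]. *)
Lemma sum_expf (c : nat) : (c < #|F|.-1)%N -> \sum_(a : F) a ^+ c = 0.
Proof.
case: c => [_|c ltc].
  rewrite (eq_bigr (fun=> 1)) => [|a _]; last exact: expr0.
  have : \sum_(a : F) a = \sum_(a : F) (a + 1).
    by rewrite (reindex_inj (addIr (1 : F))).
  by rewrite big_split => /esym/eqP; rewrite -subr_eq0 addrAC subrr add0r => /eqP.
have [g [g0 gc]] : exists g : F, g != 0 /\ g ^+ c.+1 != 1.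
  apply: contrapT => nex; have := @max_unity_roots F c.+1 (enum (predC1 (0 : F))) isT.
  rewrite -cardE cardC1 leqNgt ltc => /(_ _ (enum_uniq _)) H.
  suff /H : all c.+1.-unity_root (enum (predC1 (0 : F))) by [].
  apply/allP => g; rewrite mem_enum !inE => g0; apply/unity_rootP/eqP.
  by apply: contrapT => /negP gc; apply: nex; exists g.
have E : \sum_(a : F) a ^+ c.+1 = g ^+ c.+1 * \sum_(a : F) a ^+ c.+1.
  rewrite {1}(reindex_inj (mulfI g0)) mulr_sumr.
  by apply: eq_bigr => a _; rewrite exprMn.
move/eqP: E; rewrite -subr_eq0 -{1}[\sum__ _]mul1r -mulrBl mulf_eq0 subr_eq0.
by rewrite eq_sym (negPf gc) => /eqP.
Qed.

Variable I : finType.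
Implicit Types (h g : {ffun I -> F} -> F) (s : seq I).

(** The sequence [s] lists the variables of a monomial with multiplicity. *)
Definition orthogonal_upto (m : nat) g :=
  forall s, (size s <= m)%N -> \sum_x g x * \prod_(i <- s) x i = 0.

(* Polynomial functions of degree at most n have this property, which is
   obviously stable under products. *)
Definition lowers_by (n : nat) h :=
  forall m g, orthogonal_upto (m + n) g -> orthogonal_upto m (fun x => h x * g x).

Lemma lowers_by_const n c : lowers_by n (fun=> c).
Proof.
move=> m g go s sm; under eq_bigr do rewrite -mulrA.
by rewrite -mulr_sumr go ?mulr0 // (leq_trans sm) // leq_addr.
Qed.

Lemma lowers_byD n h1 h2 : lowers_by n h1 -> lowers_by n h2 ->
  lowers_by n (fun x => h1 x + h2 x).
Proof.
move=> l1 l2 m g go s sm; under eq_bigr do rewrite 2!mulrDl.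
by rewrite big_split /= (l1 m g go s sm) (l2 m g go s sm) addr0.
Qed.

Lemma lowers_byM n1 n2 h1 h2 : lowers_by n1 h1 -> lowers_by n2 h2 ->
  lowers_by (n1 + n2) (fun x => h1 x * h2 x).
Proof.
move=> l1 l2 m g; rewrite addnA => go s sm.
under eq_bigr do rewrite -[_ * g _]mulrA.
by apply: (l1 m (fun x => h2 x * g x)) sm; apply: l2.
Qed.

Lemma lowers_by_proj i : lowers_by 1 (fun x => x i).
Proof.
move=> m g go s sm; have := go (i :: s); rewrite addn1 ltnS => /(_ sm) E.
rewrite -[RHS]E; by apply: eq_bigr => x _; rewrite big_cons mulrA [g x * _]mulrC.
Qed.

Lemma lowers_by_sum (T : Type) (r : seq T) n (h : T -> {ffun I -> F} -> F) :
  (forall t, lowers_by n (h t)) -> lowers_by n (fun x => \sum_(t <- r) h t x).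
Proof.
move=> hl; elim: r => [|t r IHr].
  by under eq_fun do rewrite big_nil; apply: lowers_by_const.
by under eq_fun do rewrite big_cons; apply: lowers_byD.
Qed.

Lemma lowers_by_prod (T : Type) (r : seq T) n (h : T -> {ffun I -> F} -> F) :
  (forall t, lowers_by n (h t)) ->
  lowers_by (size r * n) (fun x => \prod_(t <- r) h t x).
Proof.
move=> hl; elim: r => [|t r IHr].
  by under eq_fun do rewrite big_nil; apply: lowers_by_const.
by under eq_fun do rewrite big_cons; apply: lowers_byM.
Qed.

(** A monomial of so small a degree has some exponent below [#|F|.-1]. Its sum over all points is a
    product over the variables, with a factor that vanishes by [sum_expf]. *)
Lemma orthogonal_upto1 m : (m < #|I| * #|F|.-1)%N -> orthogonal_upto m (fun=> 1).
Proof.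
move=> ltm s sm.
have [i ci] : exists i, (count_mem i s < #|F|.-1)%N.
  apply: contrapT => nex; move: (leq_ltn_trans sm ltm); apply/negP.
  rewrite -leqNgt sum_count_mem -sum_nat_const.
  apply: leq_sum => i _; rewrite leqNgt; apply/negP => lti.
  by apply: nex; exists i.
transitivity (\sum_(x : {ffun I -> F}) \prod_i x i ^+ count_mem i s).
  by apply: eq_bigr => x _; rewrite mul1r; apply: (prod_count_mem x).
rewrite -(bigA_distr_bigA (fun i a => a ^+ count_mem i s)).
by rewrite (bigD1 i) //= sum_expf ?mul0r.
Qed.

(** If 0 were the only common zero, [g] would be the indicator function of 0, with sum 1. But [g]
    has degree at most [#|J| * (#|F|.-1 * d)], which is less than [#|I| * #|F|.-1], so its sum is
    0. *)
Lemma chevalley d (J : finType) : (0 < d)%N -> (d * #|J| < #|I|)%N ->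
  solvable F d I J.
Proof.
move=> d0 ltdJ b; apply: contrapT => nex.
pose g x := \prod_j (1 - form (b j) x ^+ #|F|.-1).
have F1 : (0 < #|F|.-1)%N by rewrite -subn1 subn_gt0 finNzRing_gt1.
have expF (a : F) : a != 0 -> a ^+ #|F|.-1 = 1.
  move=> a0; apply: (mulfI a0); rewrite mulr1 -exprS prednK ?expf_card //.
  by rewrite (ltn_trans _ (finNzRing_gt1 F)).
have form_low (j : J) : lowers_by d (fun x : {ffun I -> F} => form (b j) x).
  apply: lowers_by_sum => W; rewrite -[d in lowers_by d]add0n.
  apply: lowers_byM; first exact: lowers_by_const.
  have := @lowers_by_prod _ (index_enum 'I_d) 1 (fun k x => x (W k)).
  rewrite muln1 -[size _]sum1_size sum1_card card_ord; apply => k.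
  exact: lowers_by_proj.
have glow : lowers_by (#|J| * (#|F|.-1 * d)) g.
  have -> : #|J| = size (index_enum J) by rewrite -sum1_size sum1_card.
  apply: lowers_by_prod => j; apply: lowers_byD; first exact: lowers_by_const.
  under eq_fun do rewrite -mulN1r.
  rewrite -[(_ * d)%N]add0n; apply: lowers_byM; first exact: lowers_by_const.
  have -> : (#|F|.-1 * d = size (index_enum 'I_#|F|.-1) * d)%N.
    by rewrite -[size _]sum1_size sum1_card card_ord.
  have := lowers_by_prod (r := index_enum 'I_#|F|.-1) (fun=> form_low j).
  by under eq_fun do rewrite prodr_const card_ord.
have gx (x : {ffun I -> F}) : g x = (x == [ffun=> 0])%:R.
  have [->|x0] := eqVneq.
    rewrite /g big1 // => j _.
    rewrite /form big1 ?expr0n ?(gtn_eqF F1) ?subr0 // => W _.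
    by rewrite (bigD1 (Ordinal d0)) //= ffunE mul0r mulr0.
  have [j fj] : exists j, form (b j) x != 0.
    apply: contrapT => nj; apply: nex; exists x.
      apply: contrapT => ni; case/eqP: x0; apply/ffunP => i; rewrite ffunE.
      by apply: contrapT => /eqP xi; apply: ni; exists i.
    by move=> j; apply: contrapT => /eqP fj; apply: nj; exists j.
  by rewrite /g (bigD1 j) //= expF // subrr mul0r.
have /glow/(_ [::] isT) : orthogonal_upto (0 + #|J| * (#|F|.-1 * d)) (fun=> 1).
  apply: orthogonal_upto1; rewrite add0n mulnCA mulnC ltn_pmul2r //.
  by rewrite mulnC.
under eq_bigr do rewrite big_nil !mulr1 gx.
rewrite (bigD1 [ffun=> 0]) //= eqxx big1 ?addr0 => [/eqP|x /negPf -> //].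
by rewrite oner_eq0.
Qed.

End Chevalley.
Lemma form_subst (R : comNzRingType) (I K : finType) d
    (b : {ffun 'I_d -> I} -> R) (u : I -> K -> R) (x : K -> R) :
  form b (fun i => \sum_k u i k * x k) =
  form (fun W => \sum_W1 b W1 * \prod_l u (W1 l) (W l)) x.
Proof.
rewrite /form; under eq_bigr => W1 _.
  rewrite (bigA_distr_bigA (fun l k => u (W1 l) k * x k)) mulr_sumr.
  under eq_bigr => W _ do rewrite big_split mulrA.
  over.
by rewrite exchange_big; apply: eq_bigr => W _; rewrite mulr_suml.
Qed.

Lemma form_scale (R : comNzRingType) (I : finType) d
    (b : {ffun 'I_d -> I} -> R) (c : R) (x : I -> R) :
  form b (fun i => c * x i) = c ^+ d * form b x.
Proof.
rewrite /form mulr_sumr; apply: eq_bigr => W _.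
by rewrite big_split /= prodr_const card_ord mulrCA.
Qed.

Lemma form_rmorph (R S : comNzRingType) (f : {rmorphism R -> S}) (I : finType) d
    (b : {ffun 'I_d -> I} -> R) (x : I -> R) :
  f (form b x) = form (f \o b) (f \o x).
Proof.
rewrite rmorph_sum; apply: eq_bigr => W _.
by rewrite rmorphM rmorph_prod.
Qed.

(** * Formal power series as a complete discrete valuation ring *)

Definition fps (F : fieldType) := nat -> F.
HB.instance Definition _ (F : fieldType) := Choice.copy (fps F) (nat -> F).

Section PowerSeries.
Variable F : fieldType.
Implicit Types x y z : fps F.

Lemma fpsP x y : (forall n, x n = y n) -> x = y.
Proof. exact: functional_extensionality_dep. Qed.

Definition fps_mul x y : fps F := fun n => \sum_(i < n.+1) x i * y (n - i)%N.
Definition fpsC c : fps F := fun n => if n == 0%N then c else 0.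
Definition fpsX : fps F := fun n => (n == 1%N)%:R.

Fact fps_addA : associative (fun x y : fps F => (fun n => x n + y n) : fps F).
Proof. by move=> x y z; apply: fpsP => n; apply: addrA. Qed.
Fact fps_addC : commutative (fun x y : fps F => (fun n => x n + y n) : fps F).
Proof. by move=> x y; apply: fpsP => n; apply: addrC. Qed.
Fact fps_add0 : left_id (fun=> 0 : F) (fun x y : fps F => (fun n => x n + y n) : fps F).
Proof. by move=> x; apply: fpsP => n; apply: add0r. Qed.
Fact fps_addN : left_inverse (fun=> 0 : F) (fun x : fps F => (fun n => - x n) : fps F)
  (fun x y : fps F => (fun n => x n + y n) : fps F).
Proof. by move=> x; apply: fpsP => n; apply: addNr. Qed.

HB.instance Definition _ := GRing.isZmodule.Build (fps F)
  fps_addA fps_addC fps_add0 fps_addN.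

Let trunc n x : {poly F} := \poly_(i < n) x i.

(** Each coefficient of a product depends on truncations only, so commutativity and associativity
    come from polynomials. *)
Let fps_mulE m n x y : (n < m)%N -> fps_mul x y n = (trunc m x * trunc m y)`_n.
Proof.
move=> ltnm; rewrite coefM; apply: eq_bigr => i _; rewrite !coef_poly.
by rewrite !(leq_ltn_trans _ ltnm) // ?leq_subr // -ltnS.
Qed.

Fact fps_mulC : commutative fps_mul.
Proof.
by move=> x y; apply: fpsP => n; rewrite !(fps_mulE _ _ (ltnSn n)) mulrC.
Qed.

Fact fps_mulA : associative fps_mul.
Proof.
move=> x y z; apply: fpsP => n.
transitivity ((trunc n.+1 x * (trunc n.+1 y * trunc n.+1 z))`_n).
  rewrite coefM; apply: eq_bigr => i _.
  by rewrite (@fps_mulE n.+1) ?ltnS ?leq_subr // coef_poly ltn_ord.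
rewrite mulrA coefM; apply: eq_bigr => i _.
by rewrite (@fps_mulE n.+1) // [(trunc _ z)`__]coef_poly ltnS leq_subr.
Qed.

Fact fps_mul1 : left_id (fpsC 1) fps_mul.
Proof.
move=> x; apply: fpsP => n; rewrite /fps_mul big_ord_recl subn0 mul1r.
by rewrite big1 ?addr0 // => i _; rewrite mul0r.
Qed.

Fact fps_mulD : left_distributive fps_mul +%R.
Proof.
move=> x y z; apply: fpsP => n; rewrite -[RHS]/(_ n + _ n) -big_split.
by apply: eq_bigr => i _; apply: mulrDl.
Qed.

Fact fps_oner_neq0 : fpsC 1 != 0.
Proof.
by apply/eqP => /(congr1 (fun x : fps F => x 0%N)) /eqP; rewrite oner_eq0.
Qed.

HB.instance Definition _ := GRing.Zmodule_isComNzRing.Build (fps F)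
  fps_mulA fps_mulC fps_mul1 fps_mulD fps_oner_neq0.

Lemma fps_coefD x y n : (x + y) n = x n + y n. Proof. by []. Qed.

Lemma fps_coefB x y n : (x - y) n = x n - y n. Proof. by []. Qed.

Lemma fps_coef_sum (T : Type) (r : seq T) (f : T -> fps F) n :
  (\sum_(t <- r) f t) n = \sum_(t <- r) f t n.
Proof.
by elim: r => [|t r IHr]; rewrite ?big_nil // !big_cons fps_coefD IHr.
Qed.

Lemma fps_coefMC x c n : (x * fpsC c) n = x n * c.
Proof.
rewrite mulrC -[LHS]/(fps_mul _ _ n) /fps_mul big_ord_recl subn0 mulrC.
by rewrite big1 ?addr0 // => i _; rewrite mul0r.
Qed.

Lemma fps_coef0M x y : (x * y) 0%N = x 0%N * y 0%N.
Proof. by rewrite -[LHS]/(fps_mul _ _ _) /fps_mul big_ord1. Qed.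

Fact fpsC_is_zmod_morphism : zmod_morphism fpsC.
Proof. by move=> c e; apply: fpsP => -[|n] //=; rewrite fps_coefB subrr. Qed.

Fact fpsC_is_monoid_morphism : monoid_morphism fpsC.
Proof.
by split=> // c e; apply: fpsP => -[|n]; rewrite fps_coefMC //= mul0r.
Qed.

HB.instance Definition _ := GRing.isZmodMorphism.Build F (fps F) fpsC
  fpsC_is_zmod_morphism.
HB.instance Definition _ := GRing.isMonoidMorphism.Build F (fps F) fpsC
  fpsC_is_monoid_morphism.

Definition fps_res x := x 0%N.

Fact fps_res_is_zmod_morphism : zmod_morphism fps_res.
Proof. by []. Qed.

Fact fps_res_is_monoid_morphism : monoid_morphism fps_res.
Proof. by split=> // x y; apply: fps_coef0M. Qed.

HB.instance Definition _ := GRing.isZmodMorphism.Build (fps F) F fps_res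
  fps_res_is_zmod_morphism.
HB.instance Definition _ := GRing.isMonoidMorphism.Build (fps F) F fps_res
  fps_res_is_monoid_morphism.

Lemma fps_coefXM x n : (fpsX * x) n = if n is n'.+1 then x n' else 0.
Proof.
case: n => [|n]; first by rewrite fps_coef0M mul0r.
rewrite -[LHS]/(fps_mul _ _ _) /fps_mul !big_ord_recl big1 => [|i _].
  by rewrite mul0r mul1r add0r addr0 subSS subn0.
by rewrite mul0r.
Qed.

Lemma fps_coefXnM m x n : (fpsX ^+ m * x) n = if (n < m)%N then 0 else x (n - m)%N.
Proof.
elim: m n => [|m IHm] n; first by rewrite mul1r subn0.
by rewrite exprS -mulrA fps_coefXM; case: n => [|n] //; rewrite IHm.
Qed.

Lemma fps_coefXn m n : (fpsX ^+ m) n = (n == m)%:R.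
Proof.
rewrite -[fpsX ^+ m]mulr1 fps_coefXnM; case: ltngtP => // [ltmn|->].
  by rewrite -[LHS]/(if (n - m == 0)%N then 1 else 0) subn_eq0 leqNgt ltmn.
by rewrite subnn.
Qed.

Lemma fps_divXn m x : (forall n, (n < m)%N -> x n = 0) ->
  x = fpsX ^+ m * (fun n => x (m + n)%N : F).
Proof.
move=> x0; apply: fpsP => n; rewrite fps_coefXnM.
by case: ltnP => [/x0//|le_mn]; rewrite subnKC.
Qed.

Fact fps_res_eq0 x : fps_res x = 0 <-> exists y, x = fpsX * y.
Proof.
split=> [x0|[y ->]]; last by rewrite /fps_res fps_coefXM.
exists (fun n => x n.+1); rewrite -[fpsX]expr1.
by apply: fps_divXn => -[].
Qed.

Fact fps_res_surj c : exists x, fps_res x = c.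
Proof. by exists (fpsC c). Qed.

Fact fps_unif_reg x : fpsX * x = 0 -> x = 0.
Proof.
move=> Xx0; apply: fpsP => n.
by have /(congr1 (fun y : fps F => y n.+1)) := Xx0; rewrite fps_coefXM.
Qed.

Fact fps_unif_sep x : (forall n, exists y, x = fpsX ^+ n * y) -> x = 0.
Proof.
move=> xX; apply: fpsP => n; have [y ->] := xX n.+1.
by rewrite fps_coefXnM ltnSn.
Qed.

(** The coefficient of index [k] is constant from the term [s k.+1] on, so the limit is read on a
    diagonal. *)
Fact fps_complete (s : nat -> fps F) :
  (forall n, exists y, s n.+1 - s n = fpsX ^+ n * y) ->
  exists l, forall n, exists y, l - s n = fpsX ^+ n * y.
Proof.
move=> sP; exists (fun k => s k.+1 k) => n.
have sE k m : (k < m)%N -> s m.+1 k = s m k.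
  move=> ltkm; apply/eqP; rewrite -subr_eq0 -fps_coefB.
  by have [y ->] := sP m; rewrite fps_coefXnM ltkm.
eexists; apply: fps_divXn => k ltkn; rewrite fps_coefB.
suff -> : s n k = s k.+1 k by rewrite subrr.
rewrite -(subnKC ltkn); elim: (n - k.+1)%N => [|m IHm]; first by rewrite addn0.
by rewrite addnS sE ?IHm // leq_addr.
Qed.

Definition fps_cdvr : cdvr F := @Cdvr F (fps F) fpsX fps_res
  fps_res_eq0 fps_res_surj fps_unif_reg fps_unif_sep fps_complete.

Definition fps_eqm L x y := forall n, (n < L)%N -> x n = y n.

Lemma fps_eqmM L x x1 y y1 : fps_eqm L x x1 -> fps_eqm L y y1 ->
  fps_eqm L (x * y) (x1 * y1).
Proof.
move=> xx yy n ltn; apply: eq_bigr => i _.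
by rewrite xx ?yy ?(leq_ltn_trans _ ltn) ?leq_subr // -ltnS.
Qed.

Lemma fps_eqm_form (I : finType) d (b b1 : {ffun 'I_d -> I} -> fps F)
    (x x1 : I -> fps F) L :
  (forall W, fps_eqm L (b W) (b1 W)) -> (forall i, fps_eqm L (x i) (x1 i)) ->
  fps_eqm L (form b x) (form b1 x1).
Proof.
move=> bb xx n ltn; rewrite /form !fps_coef_sum; apply: eq_bigr => W _.
apply: fps_eqmM ltn; first exact: bb.
by elim/big_ind2: _ => // *; apply: fps_eqmM.
Qed.

Definition fps_deg_lt m x := forall n, (m <= n)%N -> x n = 0.

Lemma fps_deg_ltM m n x y : fps_deg_lt m x -> fps_deg_lt n.+1 y ->
  fps_deg_lt (m + n) (x * y).
Proof.
move=> xm yn k lek; rewrite -[LHS]/(fps_mul _ _ _) /fps_mul big1 // => i _.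
have [/xm -> | ltim] := leqP m i; first by rewrite mul0r.
rewrite yn ?mulr0 // ltn_subRL.
by apply: leq_trans lek; rewrite ltn_add2r.
Qed.

Lemma fps_deg_lt_prod (T : Type) (r : seq T) (f : T -> fps F) n :
  (forall t, fps_deg_lt n.+1 (f t)) ->
  fps_deg_lt (size r * n).+1 (\prod_(t <- r) f t).
Proof.
move=> fn; elim: r => [|t r IHr]; first by rewrite big_nil => -[].
by rewrite big_cons mulSn -addSn; apply: fps_deg_ltM.
Qed.

End PowerSeries.

(** * Common zeros of forms over power series *)

Section Lang.
Variables (F : finFieldType) (d : nat) (I J : finType).
Hypotheses (d_gt0 : (0 < d)%N) (ltJI : (d ^ 2 * #|J| < #|I|)%N).
Variable b : J -> {ffun 'I_d -> I} -> fps F.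

Let primitive (v : I -> fps F) := exists i, v i 0%N != 0.

Let zero_upto M (v : I -> fps F) := forall j, fps_eqm M (form (b j) v) 0.

Lemma fps_primitive_part (v : I -> fps F) : (exists i, v i != 0) ->
  exists m (w : I -> fps F), primitive w /\ v = (fun i => fpsX F ^+ m * w i).
Proof.
case=> i vi0; have vne : exists n, [exists i, v i n != 0].
  apply: contrapT => nex; case/eqP: vi0; apply: fpsP => n.
  apply/eqP; apply: contrapT => /negP vin; apply: nex; exists n.
  by apply/existsP; exists i.
have [m /existsP[i0 vm] m_min] := ex_minnP vne.
exists m, (fun i n => v i (m + n)%N); split; first by exists i0; rewrite addn0.
apply/funext => k; apply: fps_divXn => n; apply: contraTeq => vkn.
by rewrite -leqNgt; apply: m_min; apply/existsP; exists k.
Qed.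

(* The coefficients of the unknown v, a polynomial vector of degree at most D,
   satisfy at most #|J| * (M + d * D) equations. *)
Lemma fps_approx_zero M : exists2 v, primitive v & zero_upto M v.
Proof.
(* For this [D], [d] times the number of equations is [(d ^ 2 * #|J|).+1 * D], which is less than
   the number [#|I| * D.+1] of unknowns. *)
pose D := (d * #|J| * M)%N; pose K := (I * 'I_D.+1)%type.
(* The truncated coefficients are polynomials, so finitely many equations make [v] an exact zero of
   the truncated forms. *)
pose bM j W : fps F := fun n => if (n < M)%N then b j W n else 0.
pose u (i : I) (k : K) : fps F := (i == k.1)%:R * fpsX F ^+ k.2.
pose c j (W : {ffun 'I_d -> K}) : fps F :=
  \sum_W1 bM j W1 * \prod_l u (W1 l) (W l).
pose E := (M + d * D)%N.
have cdeg j W : fps_deg_lt E (c j W).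
  move=> n leEn; rewrite /c fps_coef_sum big1 // => W1 _.
  apply: (fps_deg_ltM _ _ leEn) => [k leMk|]; first by rewrite /bM ltnNge leMk.
  have dE : size (index_enum 'I_d) = d by rewrite -sum1_size sum1_card card_ord.
  rewrite -[X in (X * D).+1]dE; apply: fps_deg_lt_prod => l k leDk; rewrite /u.
  case: eqP => _; last by rewrite mul0r.
  by rewrite mul1r fps_coefXn gtn_eqF // (leq_trans _ leDk).
have [|x [k0 xk0] xz] := @chevalley F K d (J * 'I_E)%type d_gt0 _
    (fun jt W => c jt.1 W jt.2) => //.
  rewrite !card_prod !card_ord /E /D.
  have : ((d ^ 2 * #|J|).+1 * D.+1 <= #|I| * D.+1)%N by rewrite leq_mul2r ltJI orbT.
  by rewrite /D; lia.
pose v i := \sum_k u i k * fpsC (x k).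
have vz j : form (bM j) v = 0.
  rewrite /v form_subst; apply: fpsP => t.
  rewrite /form fps_coef_sum; under eq_bigr do rewrite -rmorph_prod fps_coefMC.
  have [ltt|let_] := ltnP t E; first exact: (xz (j, Ordinal ltt)).
  by rewrite big1 // => W _; rewrite -/(c j W) cdeg ?mul0r.
have vE i (e : 'I_D.+1) : v i e = x (i, e).
  rewrite /v fps_coef_sum (bigD1 (i, e)) //= fps_coefMC /u eqxx mul1r.
  rewrite fps_coefXn eqxx mul1r big1 ?addr0 // => -[i1 e1] /= ne.
  rewrite fps_coefMC /=; case: (eqVneq i i1) ne => [<-|_ _]; last by rewrite !mul0r.
  rewrite xpair_eqE eqxx /= mul1r fps_coefXn [(_ : nat) == _]eq_sym => /negPf ne.
  by rewrite [_ == _]ne mul0r.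
have [m [w [w0 vw]]] : exists m (w : I -> fps F),
    primitive w /\ v = (fun i => fpsX F ^+ m * w i).
  apply: fps_primitive_part; exists k0.1; apply: contra_neq xk0 => v0.
  by case: k0 v0 => i e /= v0; rewrite -vE v0.
exists w => // j n ltnM.
(* By homogeneity, dividing [v] by a power of the uniformizer keeps it an exact zero of the
   truncated forms; a zero modulo a fixed power would lose precision here. *)
have wz : form (bM j) w = 0.
  have := vz j; rewrite vw form_scale -exprM.
  exact: (@unifX_reg _ (fps_cdvr F)).
rewrite -wz; apply: fps_eqm_form ltnM => // W k ltk.
by rewrite /bM ltk.
Qed.

Lemma fps_common_zero :
  exists2 v : I -> fps F, (exists i, v i != 0) & forall j, form (b j) v = 0.
Proof.
have /choice[vM vMP] M : exists v, primitive v /\ zero_upto M v.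
  by have [v ? ?] := fps_approx_zero M; exists v.
(* Compactness: coefficientwise limit along an ultrafilter. *)
have [U [Uu Uoo]] := ultraFilterLemma eventually_filter.
have [v vP] : exists v : I -> fps F, forall i n, U (fun M => vM M i n = v i n).
  suff H (i : I) (n : nat) : exists a, U (fun M => vM M i n = a).
      by exists (fun i n => sval (cid (H i n))) => i n; apply: (svalP (cid (H i n))).
  (* As [F] is finite, if no value were taken on a set of [U], all values would be avoided at some
     common [M]. *)
  apply: contrapT => nex.
  have : \forall M \near U, forall a, vM M i n != a.
    apply: filter_forall => a.
    have [Ua|//] := @in_ultra_setVsetC _ U (fun M => vM M i n = a) Uu.
      by case: nex; exists a.
    by apply: filterS => M /eqP.
  by move/filter_ex => [M /(_ (vM M i n))]; rewrite eqxx.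
have agree L : exists2 M, (L <= M)%N & forall i, fps_eqm L (v i) (vM M i).
  have UL : \forall M \near U, (L <= M)%N by apply: Uoo; exists L.
  have Uv : \forall M \near U, forall i, forall n : 'I_L, vM M i n = v i n.
    by apply: filter_forall => i; apply: filter_forall => n; apply: vP.
  have [M [/= leLM vMv]] := filter_ex (filterI UL Uv).
  by exists M => // i n ltn; rewrite (vMv i (Ordinal ltn)).
exists v => [|j].
  (* Primitivity concerns constant coefficients only, so it passes to the limit. *)
  have [M _ vMv] := agree 1%N; have [[i vi0] _] := vMP M.
  by exists i; apply: contra_neq vi0 => v0; rewrite -vMv ?v0.
apply: fpsP => n; have [M leM vMv] := agree n.+1.
rewrite (fps_eqm_form (fun _ _ _ => erefl) vMv (ltnSn n)).
by have [_ /(_ j n leM)] := vMP M.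
Qed.

End Lang.

(** * p-adic integers and rational functions *)

Section PadicCdvr.
Variables (p : nat) (p_pr : prime p).
Implicit Types (x y : padic_int p_pr) (k n m : nat).

Lemma padic_coefB x y n : padic_val (x - y) n = padic_val x n - padic_val y n.
Proof. by []. Qed.

Lemma padic_intP x y : (forall n, padic_val x n = padic_val y n) -> x = y.
Proof. by move=> xy; apply/val_inj/padic_seqP. Qed.

Lemma padic_intPn x y : (forall n, padic_val x n = padic_val y n :> nat) -> x = y.
Proof. by move=> xy; apply: padic_intP => n; apply/val_inj/xy. Qed.

Lemma padic_int_of_nat (f : nat -> nat) :
  (forall n, f n.+1 = f n %[mod p ^ n.+1]) ->
  exists x, forall n, (padic_val x n) = (f n %% p ^ n.+1)%N :> nat.
Proof.
move=> fP; pose s : padic_seq p := fun n => (f n)%:R.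
have sE n : s n = (f n %% p ^ n.+1)%N :> nat.
  by rewrite val_Zp_nat // -(padic_modulus p_pr n).
have sP : s \in padic_compat p_pr.
  apply/padic_compatP => n; rewrite !sE modn_mod modn_dvdm ?fP //.
  by rewrite dvdn_exp2l.
by exists (PadicInt sP).
Qed.

Lemma padic_coef_nat k n : padic_val (k%:R : padic_int p_pr) n = (k %% p ^ n.+1)%N :> nat.
Proof.
elim: k => [|k IHk]; first by rewrite mod0n.
rewrite -[k.+1]addn1 natrD -[LHS]/((padic_val (k%:R : padic_int p_pr) + 1)%R n : nat).
rewrite (padic_seq_addE p_pr) IHk modnDml.
have -> : ((1%R : padic_seq p) n : nat) = (1 %% p ^ n.+1)%N.
  by rewrite -[in RHS](padic_modulus p_pr n).
by rewrite modnDmr.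
Qed.

Lemma padic_coef_mulXn n y k :
  (padic_val (p%:R ^+ n * y) k) = (p ^ n * padic_val y k %% p ^ k.+1)%N :> nat.
Proof.
rewrite -natrX -[LHS]/((padic_val (p ^ n)%:R * padic_val y)%R k : nat).
by rewrite (padic_seq_mulE p_pr) padic_coef_nat modnMml.
Qed.

Lemma padic_mulXnP n x :
  (exists y, x = p%:R ^+ n * y) <-> (forall k, (k < n)%N -> (padic_val x k) = 0).
Proof.
split=> [[y ->] k ltkn|x0].
  apply: val_inj; apply: etrans (padic_coef_mulXn n y k) _.
  by rewrite -(subnKC ltkn) expnD -mulnA modnMr.
have dvd_x k : (p ^ n %| (padic_val x (k + n)))%N.
  case: n x0 => [|n] x0; first by rewrite dvd1n.
  by rewrite /dvdn (@padic_compat_le _ _ x n) ?x0 ?mod0n // addnS leqW // leq_addl.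
(* The coordinate [k] of the quotient is known modulo [p ^ k.+1], which requires [x] modulo
   [p ^ (k + n).+1], its coordinate [k + n]. *)
have [k|y yE] := @padic_int_of_nat (fun k => padic_val x (k + n)%N %/ p ^ n)%N.
  rewrite !modn_divl -expnD addSn; congr (_ %/ _)%N.
  by rewrite (@padic_compat_le _ _ x (k + n) (k + n).+1).
exists y; apply: padic_intPn => k; rewrite padic_coef_mulXn yE modnMmr mulnC.
rewrite divnK // (@padic_compat_le _ _ x k) ?leq_addr // modn_small //.
exact: padic_seq_lt.
Qed.

Definition padic_res x : 'F_p := ((padic_val x 0%N) : nat)%:R.

Fact padic_res_is_zmod_morphism : zmod_morphism padic_res.
Proof.
suff resD x y : padic_res (x + y) = padic_res x + padic_res y.
  by move=> x y; apply/eqP; rewrite -subr_eq opprK -resD subrK.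
rewrite /padic_res -natrD -[in RHS]Fp_nat_mod //; congr (_%:R).
exact: (padic_seq_addE p_pr (padic_val x) (padic_val y) 0).
Qed.

Fact padic_res_is_monoid_morphism : monoid_morphism padic_res.
Proof.
split; first by rewrite /padic_res.
move=> x y; rewrite /padic_res -natrM -[in RHS]Fp_nat_mod //; congr (_%:R).
exact: (padic_seq_mulE p_pr (padic_val x) (padic_val y) 0).
Qed.

HB.instance Definition _ := GRing.isZmodMorphism.Build (padic_int p_pr) 'F_p padic_res
  padic_res_is_zmod_morphism.
HB.instance Definition _ := GRing.isMonoidMorphism.Build (padic_int p_pr) 'F_p padic_res
  padic_res_is_monoid_morphism.

Fact padic_res_eq0 x : padic_res x = 0 <-> exists y, x = p%:R * y.
Proof.
rewrite -[p%:R]expr1 padic_mulXnP; split=> [x0 [|//] _|/(_ 0%N isT) x0].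
  apply: val_inj => /=; move/eqP: x0; rewrite -(dvdn_pcharf (pchar_Fp p_pr)).
  by rewrite /dvdn modn_small => [/eqP//|]; apply: (padic_seq_lt p_pr (padic_val x) 0).
by rewrite /padic_res x0.
Qed.

Fact padic_res_surj (c : 'F_p) : exists x, padic_res x = c.
Proof.
exists (c : nat)%:R; rewrite /padic_res padic_coef_nat expn1 Fp_nat_mod //.
exact: natr_Zp.
Qed.

Fact padic_unif_reg x : p%:R * x = 0 -> x = 0.
Proof.
move/padic_int_integral => /orP[/eqP p0|/eqP//].
have /(congr1 (fun y => (padic_val y 1%N) : nat)) := p0.
rewrite padic_coef_nat modn_small; last by rewrite ltn_Pmulr ?expn1 ?prime_gt1 ?prime_gt0.
by move/eqP; rewrite (gtn_eqF (prime_gt0 p_pr)).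
Qed.

Fact padic_unif_sep x : (forall n, exists y, x = p%:R ^+ n * y) -> x = 0.
Proof.
by move=> xp; apply: padic_intP => n; have /padic_mulXnP-> := xp n.+1.
Qed.

Fact padic_complete (s : nat -> padic_int p_pr) :
  (forall n, exists y, s n.+1 - s n = p%:R ^+ n * y) ->
  exists l, forall n, exists y, l - s n = p%:R ^+ n * y.
Proof.
move=> sP; have sE k m : (k < m)%N -> (padic_val (s m) k) = (padic_val (s k.+1) k).
  move=> ltkm; rewrite -(subnKC ltkm); elim: (m - k.+1)%N => [|i IHi]; first by rewrite addn0.
  have /padic_mulXnP/(_ k) := sP (k.+1 + i)%N; rewrite leq_addr => /(_ isT) /eqP.
  by rewrite padic_coefB subr_eq0 -addnS => /eqP ->.
have [n|l lE] := @padic_int_of_nat (fun k => (padic_val (s k.+1) k)).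
  by rewrite -(sE n n.+2) // (@padic_compat_le _ _ (s n.+2) n n.+1).
exists l => n; apply/padic_mulXnP => k ltkn; rewrite padic_coefB (sE k n) //.
apply/eqP; rewrite subr_eq0; apply/eqP/val_inj; rewrite /= lE modn_small //.
exact: padic_seq_lt.
Qed.

Definition padic_cdvr : cdvr 'F_p := @Cdvr 'F_p (padic_int p_pr) p%:R padic_res
  padic_res_eq0 padic_res_surj padic_unif_reg padic_unif_sep padic_complete.

End PadicCdvr.
Lemma solvable_padic d (I J : finType) :
  (0 < d)%N -> (d ^ 2 * #|J| < #|I|)%N -> exists e,
  forall p (p_pr : prime p), (e < p)%N -> solvable (padic_int p_pr) d I J.
Proof.
move=> d0 ltJI; have [e H] := solvable_transfer d I J.
exists e => p p_pr ltep; apply: (H 'F_p (padic_cdvr p_pr) (fps_cdvr 'F_p)).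
  move=> i /andP[i0 lei]; rewrite -(dvdn_pcharf (pchar_Fp p_pr)).
  by rewrite gtnNdvd // (leq_ltn_trans lei).
by move=> b; apply: fps_common_zero.
Qed.

(** * Clearing denominators *)

Section Fractions.
Variable O : idomainType.

Lemma tofrac_den (x : {fraction O}) :
  exists n d, d != 0 /\ tofrac d * x = tofrac n.
Proof.
elim/quotW: x => r; exists \n_r, \d_r; split; first exact: denom_ratioP.
unlock FracField.tofrac; rewrite -[LHS]FracField.pi_mul; apply/eqmodP.
rewrite /= FracField.equivfE /FracField.mulf.
by rewrite !numden_Ratio ?mulf_neq0 ?oner_neq0 ?denom_ratioP //= !mul1r mulr1 mulrC.
Qed.

Lemma tofrac_common_den (T : finType) (f : T -> {fraction O}) :
  exists (g : T -> O) d, d != 0 /\ forall t, tofrac d * f t = tofrac (g t).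
Proof.
have /choice[nd ndP] t : exists nd : O * O, nd.2 != 0 /\ tofrac nd.2 * f t = tofrac nd.1.
  by have [n [d ?]] := tofrac_den (f t); exists (n, d).
exists (fun t => (\prod_(t1 | t1 != t) (nd t1).2) * (nd t).1), (\prod_t (nd t).2); split.
  by apply/prodf_neq0 => t _; have [] := ndP t.
move=> t; have [_ ntE] := ndP t.
by rewrite (bigD1 t) //= !tofracM -ntE mulrA; congr (_ * _); apply: mulrC.
Qed.

Lemma solvable_fraction d (I J : finType) :
  solvable O d I J -> solvable {fraction O} d I J.
Proof.
move=> solO b.
have [g [c [c0 gE]]] := tofrac_common_den (fun jW : J * {ffun 'I_d -> I} => b jW.1 jW.2).
have [x [i xi0] xz] := solO (fun j W => g (j, W)).
exists (fun i => tofrac (x i)) => [|j]; first by exists i; rewrite tofrac_eq0.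
apply: (mulfI (x := tofrac c)); first by rewrite tofrac_eq0.
rewrite mulr0; transitivity (tofrac (form (fun W => g (j, W)) x)).
  rewrite form_rmorph /form mulr_sumr.
  by apply: eq_bigr => W _; rewrite mulrA (gE (j, W)).
by rewrite xz tofrac0.
Qed.

End Fractions.

(** * Substitution of polynomials of bounded degree *)

Section BoxDegree.
Variables (R : comNzRingType) (n : nat).
Implicit Types p q : {mpoly R[n]}.

(* Bounding the degree in each variable rather than the total degree makes
   monomials easier to count. *)
Definition box_deg (m : nat) p := forall a, p@_a != 0 -> forall i, (a i <= m)%N.

Lemma box_deg_msize m p : (msize p <= m.+1)%N -> box_deg m p.
Proof.
move=> pm a; rewrite mcoeff_eq0 negbK => /msize_mdeg_lt lta i.
have := leq_trans lta pm; rewrite ltnS; apply: leq_trans.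
by rewrite mdegE (bigD1 i) //= leq_addr.
Qed.

Lemma box_deg_sum m (T : Type) (r : seq T) (f : T -> {mpoly R[n]}) :
  (forall t, box_deg m (f t)) -> box_deg m (\sum_(t <- r) f t).
Proof.
move=> fm a; elim: r => [|t r IHr]; first by rewrite big_nil mcoeff0 eqxx.
rewrite big_cons mcoeffD; have [-> |/fm //] := eqVneq (f t)@_a 0.
by rewrite add0r.
Qed.

Lemma box_degM m1 m2 p q :
  box_deg m1 p -> box_deg m2 q -> box_deg (m1 + m2) (p * q).
Proof.
move=> p1 q2 a; rewrite mcoeff_eq0 negbK => /msuppM_le /allpairsP[[a1 a2]] /=.
case=> pa1 qa2 -> i; rewrite mnmDE leq_add //.
  by apply: p1; rewrite mcoeff_eq0 negbK.
by apply: q2; rewrite mcoeff_eq0 negbK.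
Qed.

Lemma box_deg_prod m (T : Type) (r : seq T) (f : T -> {mpoly R[n]}) :
  (forall t, box_deg m (f t)) -> box_deg (size r * m) (\prod_(t <- r) f t).
Proof.
move=> fm; elim: r => [|t r IHr]; last by rewrite big_cons mulSn; apply: box_degM.
by rewrite big_nil; apply: box_deg_msize; rewrite msize1.
Qed.

Lemma mcoeff_form (I : finType) d (b : {ffun 'I_d -> I} -> {mpoly R[n]})
    (x : I -> R) a :
  (form b (fun i => (x i)%:MP))@_a = form (fun W => (b W)@_a) x.
Proof.
rewrite /form raddf_sum /=; apply: eq_bigr => W _.
by rewrite -rmorph_prod /= mulrC mcoeffCM mulrC.
Qed.

End BoxDegree.

(** Replaces an exponent vector by the list of its variables, as needed to view a homogeneous
    polynomial as a [form]; [i0] is only the default of [nth]. *)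
Lemma prod_exp_mnm (R : comNzRingType) m (i0 : 'I_m) (v : 'I_m -> R) (a : 'X_{1..m}) :
  \prod_i v i ^+ a i = \prod_(l < mdeg a) v (nth i0 (m2s a) l).
Proof.
transitivity (\prod_(j <- m2s a) v j); last first.
  by rewrite (big_nth i0) big_mkord size_m2s.
rewrite [RHS]prod_count_mem; apply: eq_bigr => i _.
by rewrite -[in LHS](s2mK a) mnmE.
Qed.

Section Isotropy.
Variables (k : fieldType) (d s n t m0 m : nat).
Hypothesis solk : solvable k d ('I_m0 * {ffun 'I_n -> 'I_t.+1})%type
  {ffun 'I_n -> 'I_(s + d * t).+1}.

(** The first [m0] variables are replaced with polynomials of degree at most [t] in each variable,
    with unknown coefficients in [k], and the others with 0. Each coefficient of the result is a
    form of degree [d] in the unknowns. *)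
Lemma form_isotropic (psi : {mpoly (ratfun k n)[m]}) :
  (m0 <= m)%N -> psi \is d.-homog -> coeffs_le s psi -> ~ anisotropic psi.
Proof.
move=> le_m0m /dhomogP psi_d psi_s.
have /choice[q qP] (a : 'X_{1..m}) : exists q : {mpoly k[n]},
    (msize q <= s.+1)%N /\ psi@_a = tofrac q.
  by have [q ? ?] := psi_s a; exists q.
pose I := ('I_m0 * {ffun 'I_n -> 'I_t.+1})%type.
pose mon (e : {ffun 'I_n -> 'I_t.+1}) : 'X_{1..n} := [multinom (e i : nat) | i < n].
pose u (i : 'I_m) (e : I) : {mpoly k[n]} := (i == widen_ord le_m0m e.1)%:R * 'X_[mon e.2].
(* A solution of the zero system shows that ['I_m0] is inhabited, which gives a default for
   [nth]. *)
have [_ [[j0 _] _] _] := solk (fun _ _ => 0); pose i0 := widen_ord le_m0m j0.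
(* Each monomial of [psi] contributes its whole coefficient at a single word, the list of its
   variables. *)
pose w (a : 'X_{1..m}) : {ffun 'I_d -> 'I_m} := [ffun l => nth i0 (m2s a) (val l)].
pose b (W : {ffun 'I_d -> 'I_m}) : {mpoly k[n]} :=
  \sum_(a <- msupp psi) (if W == w a then q a else 0).
have psiE (v : 'I_m -> {mpoly k[n]}) : psi.@[fun i => tofrac (v i)] = tofrac (form b v).
  rewrite mevalE rmorph_sum /=; under [RHS]eq_bigr => W _.
    rewrite mulr_suml rmorph_sum; over.
  rewrite exchange_big big_seq [RHS]big_seq; apply: eq_bigr => a sa.
  rewrite [RHS](bigD1 (w a)) //= eqxx [X in _ + X]big1 => [|W /negPf ->]; last first.
    by rewrite mul0r rmorph0.
  rewrite addr0.
  rewrite rmorphM (qP a).2 rmorph_prod; congr (_ * _).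
  rewrite (prod_exp_mnm i0) psi_d //.
  by apply: eq_bigr => l _; rewrite ffunE.
pose c (W : {ffun 'I_d -> I}) := \sum_W1 b W1 * \prod_l u (W1 l) (W l).
pose mon1 (e : {ffun 'I_n -> 'I_(s + d * t).+1}) : 'X_{1..n} := [multinom (e i : nat) | i < n].
have c_deg W : box_deg (s + d * t) (c W).
  apply: box_deg_sum => W1; apply: box_degM.
    apply: box_deg_sum => a; apply: box_deg_msize; case: ifP => _.
      by have [] := qP a.
    by rewrite msize0.
  have dE : size (index_enum 'I_d) = d by rewrite -sum1_size sum1_card card_ord.
  rewrite -[X in (X * t)%N]dE; apply: box_deg_prod => l a.
  rewrite /u; case: (W1 l =P _) => _; last by rewrite mul0r mcoeff0 eqxx.
  rewrite mul1r mcoeffX; case: (mon _ =P a) => [<- _ i1|_]; last by rewrite eqxx.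
  by rewrite mnmE -ltnS.
have [x [[i1 e1] x_neq0] xz] := solk (fun e W => (c W)@_(mon1 e)).
pose v (i : 'I_m) := \sum_e u i e * (x e)%:MP.
have vz : psi.@[fun i => tofrac (v i)] = 0.
  rewrite psiE form_subst -[RHS]tofrac0; congr (tofrac _).
  apply/mpolyP => a; rewrite mcoeff_form mcoeff0.
  have [lea|] := boolP [forall i, (a i <= s + d * t)%N].
    rewrite -[RHS](xz [ffun i => inord (a i)]); apply: eq_bigr => W _.
    congr (_@__ * _); apply/mnmP => i; rewrite mnmE ffunE inordK // ltnS.
    exact: (forallP lea).
  rewrite negb_forall => /existsP[i /negP nle].
  apply: big1 => W _; have [-> |/c_deg/(_ i)//] := eqVneq (c W)@_a 0.
  by rewrite mul0r.
(* The coefficient of [v] at [i1] and [mon e1] is [x (i1, e1)], which is nonzero. *)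
move=> /(_ _ vz (widen_ord le_m0m i1)) /eqP; rewrite tofrac_eq0 => /eqP v0.
case/eqP: x_neq0; have /(congr1 (mcoeff (mon e1))) := v0.
rewrite mcoeff0 => <-; rewrite /v raddf_sum (bigD1 (i1, e1)) //= /u.
rewrite eqxx mul1r [_ * _%:MP]mulrC mcoeffCM mcoeffX eqxx mulr1 big1 ?addr0 //.
move=> [i e] /= ne; rewrite mulrC mcoeffCM.
case: (eqVneq i1 i) ne => [<-|ne1 _].
  rewrite xpair_eqE !eqxx mul1r mcoeffX => /eqP ne.
  case: (mon e =P _) => [/mnmP ee|_]; last by rewrite mulr0.
  by case: ne; apply/ffunP => l; have := ee l; rewrite !mnmE => /val_inj.
have -> : (widen_ord le_m0m i1 == widen_ord le_m0m i) = false.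
  by apply/negbTE; apply: contra_neq ne1 => /(congr1 val) /= /val_inj.
by rewrite mul0r mcoeff0 mulr0.
Qed.

End Isotropy.

(** * Isometry, counting of unknowns, and conclusion *)

Lemma isometric_anisotropic (F : fieldType) m (phi psi : {mpoly F[m]}) :
  isometric phi psi -> anisotropic phi -> anisotropic psi.
Proof.
move=> [A uA ->] aphi v; rewrite comp_mpoly_meval => /aphi Av0.
have : A *m \col_j v j = 0.
  apply/colP => i; rewrite !mxE -[RHS](Av0 i) tnth_mktuple rmorph_sum.
  by apply: eq_bigr => j _; rewrite /= mevalZ mevalXU mxE.
move=> /(congr1 (mulmx (invmx A))); rewrite mulmxA mulVmx // mul1mx mulmx0.
by move=> /colP v0 i; have := v0 i; rewrite !mxE.
Qed.

(** The leading term of [(d * q).+1 ^ n] in [q] is [(d * q) ^ n], and the rest is at most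
    [c * q ^ n.-1] when [n] is positive. The factor [q] on both sides avoids a negative exponent at
    [n = 0]. *)
Lemma expn_affine_bound d n : exists c, forall q, (0 < q)%N ->
  ((d * q).+1 ^ n * q <= q ^ n * (d ^ n * q + c))%N.
Proof.
elim: n => [|n [c IHn]]; first by exists 0%N => q _; rewrite !expn0 !mul1n addn0.
exists (d ^ n + d * c + c)%N => q q0; rewrite expnS -mulnA.
apply: leq_trans (leq_mul (leqnn _) (IHn q q0)) _.
rewrite mulnCA (expnSr q) -mulnA leq_mul2l; apply/orP; right.
rewrite (expnS d).
have : (c <= q * c)%N by rewrite leq_pmull.
by move: (d ^ n)%N => D; nia.
Qed.

(** For large [t] the left side grows like [d ^ n.+2 * t ^ n], so a single additional variable is
    enough. *)
Lemma card_box_bound d s n : exists t,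
  (d ^ 2 * (s + d * t).+1 ^ n < (d ^ n.+2).+1 * t.+1 ^ n)%N.
Proof.
have [c H] := expn_affine_bound d n.
have [q q0 ltq] : exists2 q, (0 < q)%N & (d ^ 2 * c < q)%N.
  by exists (d ^ 2 * c).+1.
(* Then [t.+1 = s.+1 * q] and [(s + d * t).+1 <= s.+1 * (d * q).+1], so the factor [s.+1 ^ n]
   cancels; [q > d ^ 2 * c] absorbs the error term. *)
exists (s.+1 * q).-1.
rewrite prednK ?muln_gt0 ?q0 //.
have wexp a b : (a <= b)%N -> (a ^ n <= b ^ n)%N.
  by move=> leab; elim: (n) => // i IHi; rewrite !expnS leq_mul.
apply: (@leq_ltn_trans (d ^ 2 * (s.+1 * (d * q).+1) ^ n)).
  by rewrite leq_mul2l; apply/orP; right; apply: wexp; nia.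
rewrite !expnMn !(mulnCA _ (s.+1 ^ n)%N) ltn_pmul2l ?expn_gt0 //.
rewrite -(ltn_pmul2r (_ : 0 < q)%N) // -mulnA.
apply: (leq_ltn_trans (leq_mul (leqnn _) (H q q0))).
have -> : (d ^ n.+2 = d ^ 2 * d ^ n)%N by rewrite -expnD.
have : (q ^ n * (d ^ 2 * c) < q ^ n * q)%N by rewrite ltn_pmul2l // expn_gt0 q0.
by move: (d ^ n)%N (q ^ n)%N (d ^ 2)%N => D Q E; lia.
Qed.

Theorem theorem4 (R : realType) (d : nat) (d_ge1 : (1 <= d)%N) :
  forall n s : nat, (0 < n)%N -> (0 < s)%N ->
  exists P : seq nat, all prime P /\
    forall (p : nat) (p_pr : prime p), p \notin P ->
      (mu R d s (padic_field p_pr) n <= ((d ^ n.+2)%N%:R)%:E)%E.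
Proof.
move=> n s _ _; have [t ltt] := card_box_bound d s n.
(* Keeping exactly [(d ^ n.+2).+1] variables fixes the shape of the system, so [e] does not depend
   on the dimension [m] of the form. *)
have [|e He] := @solvable_padic d ('I_(d ^ n.+2).+1 * {ffun 'I_n -> 'I_t.+1})%type
    {ffun 'I_n -> 'I_(s + d * t).+1} d_ge1.
  by rewrite card_prod !card_ffun !card_ord.
exists [seq p <- iota 0 e.+1 | prime p]; split; first exact: filter_all.
move=> p p_pr; rewrite mem_filter p_pr mem_iota /= add0n ltnS -ltnNge => ltep.
apply: ge_ereal_sup => _ [m [phi [phi_d [psi [psi_d psi_s isom]]] aphi] <-].
rewrite lee_fin Num.Theory.ler_nat leqNgt; apply/negP => ltm.
apply: (form_isotropic (solvable_fraction (He p p_pr ltep)) ltm psi_d psi_s).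
exact: isometric_anisotropic isom aphi.
Qed.
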